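(* Let $d\ge1$ and $\varepsilon>0$. Assume that $r_\varepsilon$ is an admissible denominator, that $V:\mathbb R^d\to\mathbb R$ is measurable with $V\ge0$, and that $\beta\ge0$, $\delta>0$, $\sigma>0$. Then the functional $$\mathcal E_{\varepsilon,\sigma}(\rho)=\int_{\mathbb R^d}\Big[\frac{|\nabla\rho|^2}{8r_\varepsilon(\rho)}+V(x)p_\sigma(\rho)+\frac\beta2\rho^2+\frac\delta2|\nabla\rho|^2\Big]dx$$ is strictly convex on $\mathcal A$. If $\beta>0$, it is strongly convex on $\mathcal A$ with respect to the $L^2$ norm.
   Context: Admissible set: $$\mathcal A=\Big\{\rho\in H^1(\mathbb R^d):\ \rho\ge0,\ \int_{\mathbb R^d}\rho\,dx=1,\ \int_{\mathbb R^d}V\rho\,dx<\infty\Big\}.$$ Admissible denominators: a family $\{r_\varepsilon\}_{\varepsilon>0}$ of functions on $[0,\infty)$ is admissible if for every $\varepsilon>0$: $r_\varepsilon\in C^1([0,\infty))$, $r_\varepsilon>0$, $r_\varepsilon'\ge0$, and $r_\varepsilon$ is concave; and for every $s\ge 0$: $s\le r_{\varepsilon_1}(s)\le r_{\varepsilon_2}(s)$ whenever $0<\varepsilon_1\le\varepsilon_2$, and $r_\varepsilon(s)\to s$ as $\varepsilon\to0^+$. ''$r_\varepsilon$ is admissible'' means it is a member of such a family. Potential regularization: $p_\sigma(s)=\sqrt{s^2+\sigma^2}-\sigma$ for $s\ge0$. Strong convexity with respect to a norm $\|\cdot\|$ means there is $m>0$ with $\mathcal E(\theta\rho_1+(1-\theta)\rho_2)\le\theta\mathcal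 E(\rho_1)+(1-\theta)\mathcal E(\rho_2)-\frac m2\theta(1-\theta)\|\rho_1-\rho_2\|^2$ for all $\rho_1,\rho_2\in\mathcal A$, $\theta\in[0,1]$. *)

(* Defs.v *)
From HB Require Import structures.
From mathcomp Require Import all_boot all_order all_algebra.
From mathcomp Require Import all_classical all_reals all_analysis.
From mathcomp Require Import measurable_realfun.

Set Implicit Arguments.
Unset Strict Implicit.
Unset Printing Implicit Defensive.
Import Order.TTheory GRing.Theory Num.Theory.
Import numFieldNormedType.Exports.

Local Open Scope classical_set_scope.
Local Open Scope ring_scope.

(** R^d is ['rV[R]_d], with the sigma-algebra generated by the coordinates,
    i.e. the Borel sigma-algebra. *)

Definition rV_display : measure_display.
Proof. exact: default_measure_display. Qed.

Section measurable_rV.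
Context {R : realType}.
Variable n : nat.

Definition rV_coord (i : 'I_n) (x : 'rV[R]_n) : measurableTypeR R := x ord0 i.

Let rV_set0 : g_sigma_preimage rV_coord set0.
Proof. exact: sigma_algebra0. Qed.

Let rV_setC A : g_sigma_preimage rV_coord A -> g_sigma_preimage rV_coord (~` A).
Proof. exact: sigma_algebraC. Qed.

Let rV_bigcup (F : _^nat) : (forall i, g_sigma_preimage rV_coord (F i)) ->
  g_sigma_preimage rV_coord (\bigcup_i (F i)).
Proof. exact: sigma_algebra_bigcup. Qed.

HB.instance Definition _ := @isMeasurable.Build rV_display
  'rV[R]_n (g_sigma_preimage rV_coord) rV_set0 rV_setC rV_bigcup.

End measurable_rV.

Lemma measurable_rV_coord (R : realType) n (i : 'I_n) :
  measurable_fun [set: 'rV[R]_n] (rV_coord i).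
Proof.
move=> _ Y mY; rewrite setTI; apply: sub_sigma_algebra => /=.
rewrite -bigcup_seq/=; exists i => /=; first by rewrite mem_index_enum.
by exists Y => //; rewrite setTI.
Qed.

Lemma measurable_fun_rVP d (T : measurableType d) (R : realType) n
    (f : T -> 'rV[R]_n) :
  (forall i, measurable_fun setT (rV_coord i \o f)) -> measurable_fun setT f.
Proof.
move=> mf _ A mA; rewrite setTI.
have : preimage_set_system setT f (g_sigma_preimage (@rV_coord R n))
    `<=` measurable.
  rewrite -g_sigma_preimageE; apply: smallest_sub.
    exact: sigma_algebra_measurable.
  move=> _ [B + <-]; rewrite setTI -bigcup_seq => -[i _] [C mC <-].
  by rewrite setTI -comp_preimage -[X in measurable X]setTI; exact: mf.
by apply; exists A => //; rewrite setTI.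
Qed.

Section rV_cons.
Context {R : realType}.
Variable n : nat.

Definition rV_cons (p : measurableTypeR R * 'rV[R]_n) : 'rV[R]_n.+1 :=
  \row_i if unlift ord0 i is Some j then p.2 ord0 j else p.1.

Definition rV_uncons (x : 'rV[R]_n.+1) : measurableTypeR R * 'rV[R]_n :=
  (x ord0 ord0, \row_j x ord0 (lift ord0 j)).

Lemma rV_consK : cancel rV_cons rV_uncons.
Proof.
move=> [a v]; rewrite /rV_uncons mxE unlift_none; congr pair.
by apply/rowP => j; rewrite !mxE liftK.
Qed.

Lemma rV_unconsK : cancel rV_uncons rV_cons.
Proof.
move=> x; apply/rowP => i; rewrite mxE; case: unliftP => [j|] -> //=.
by rewrite mxE.
Qed.

Lemma measurable_rV_cons : measurable_fun setT rV_cons.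
Proof.
apply: measurable_fun_rVP => i; rewrite /rV_coord /rV_cons.
case: (unliftP ord0 i) => [j|] ->.
- rewrite (_ : _ \o _ = rV_coord j \o snd).
    by apply: measurableT_comp => //; exact: measurable_rV_coord.
  by apply/funext => p /=; rewrite mxE liftK.
- rewrite (_ : _ \o _ = fst)//.
  by apply/funext => p /=; rewrite mxE unlift_none.
Qed.

Lemma measurable_rV_uncons : measurable_fun setT rV_uncons.
Proof.
apply/measurable_fun_pairP; split.
  exact: (measurable_rV_coord ord0).
apply: measurable_fun_rVP => j.
rewrite (_ : _ \o _ = rV_coord (lift ord0 j)); last first.
  by apply/funext => x; rewrite /rV_coord /= mxE.
exact: measurable_rV_coord.
Qed.

Section step.
Variable mu : {sigma_finite_measure set 'rV[R]_n -> \bar R}.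


Definition lebesgue_rV_step : set 'rV[R]_n.+1 -> \bar R :=
  pushforward (@lebesgue_measure R \x mu)%E rV_cons.

Let step0 : (lebesgue_rV_step set0 = 0)%E.
Proof. by rewrite /lebesgue_rV_step /pushforward preimage_set0 measure0. Qed.

Let step_ge0 A : (0 <= lebesgue_rV_step A)%E.
Proof. by rewrite /lebesgue_rV_step /pushforward measure_ge0. Qed.

Let step_sigma_additive : semi_sigma_additive lebesgue_rV_step.
Proof.
move=> F mF tF mUF; rewrite /lebesgue_rV_step /pushforward preimage_bigcup.
apply: measure_semi_sigma_additive.
- by move=> k; rewrite -[X in measurable X]setTI; exact: measurable_rV_cons.
- apply/trivIsetP => /= i j _ _ ij; rewrite -preimage_setI.
  by move/trivIsetP : tF => /(_ _ _ _ _ ij) ->//; rewrite preimage_set0.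
- by rewrite -preimage_bigcup -[X in measurable X]setTI; exact: measurable_rV_cons.
Qed.

HB.instance Definition _ := isMeasure.Build _ _ _ lebesgue_rV_step
  step0 step_ge0 step_sigma_additive.

Let step_sigma_finite : sigma_finite setT lebesgue_rV_step.
Proof.
have /sigma_finiteP[F [TF ndF Foo]] := sigma_finiteT (@lebesgue_measure R).
have /sigma_finiteP[G [TG ndG Goo]] := sigma_finiteT mu.
exists (fun k => rV_uncons @^-1` (F k `*` G k)).
  apply/esym; rewrite -subTset => x _.
  have : (\bigcup_k F k) (rV_uncons x).1 by rewrite -TF.
  have : (\bigcup_k G k) (rV_uncons x).2 by rewrite -TG.
  move=> [l _ Gl] [k _ Fk]; exists (maxn k l) => //; split.
  - by move: Fk; exact/subsetPset/ndF/leq_maxl.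
  - by move: Gl; exact/subsetPset/ndG/leq_maxr.
move=> k; have [mF Fk] := Foo k; have [mG Gk] := Goo k.
split.
  rewrite -[X in measurable X]setTI; apply: measurable_rV_uncons => //.
  exact: measurableX.
rewrite /lebesgue_rV_step /pushforward -comp_preimage.
rewrite (_ : _ \o _ = id); last by apply/funext => p /=; rewrite rV_consK.
rewrite preimage_id product_measure1E//.
by rewrite lte_mul_pinfty// ge0_fin_numE.
Qed.

HB.instance Definition _ := @Measure_isSigmaFinite.Build _ _ _
  lebesgue_rV_step step_sigma_finite.

End step.
End rV_cons.

Fixpoint lebesgue_rV (R : realType) (n : nat) :
    {sigma_finite_measure set 'rV[R]_n -> \bar R} :=
  match n with
  | 0 => [the {sigma_finite_measure set 'rV[R]_0 -> \bar R} of \d_ (0 : 'rV[R]_0)]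
  | m.+1 => [the {sigma_finite_measure set 'rV[R]_m.+1 -> \bar R} of
             lebesgue_rV_step (lebesgue_rV R m)]
  end.

Lemma measurable_rV_box (R : realType) n (A : 'I_n -> set (measurableTypeR R)) :
  (forall i, measurable (A i)) ->
  measurable [set x : 'rV[R]_n | forall i, A i (x ord0 i)].
Proof.
move=> mA; rewrite (_ : [set x | _] =
    \big[setI/setT]_(i < n) (rV_coord i @^-1` A i)).
  apply: bigsetI_measurable => i _.
  by rewrite -[X in measurable X]setTI; exact: measurable_rV_coord.
rewrite -bigcap_seq; apply/seteqP; split=> x /=.
  by move=> Ax i _; exact: Ax.
by move=> Ax i; apply: (Ax i); rewrite /= mem_index_enum.
Qed.

Lemma lebesgue_rV_box (R : realType) n (A : 'I_n -> set (measurableTypeR R)) :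
  (forall i, measurable (A i)) ->
  (lebesgue_rV R n [set x | forall i, A i (x ord0 i)] =
   \prod_(i < n) lebesgue_measure (A i))%E.
Proof.
elim: n A => [|n IH] A mA.
  rewrite big_ord0 /= diracE.
  by rewrite mem_set//= => -[].
rewrite big_ord_recl.
change ((@lebesgue_measure R \x lebesgue_rV R n)%E
  (@rV_cons R n @^-1` [set x | forall i, A i (x ord0 i)]) =
  (lebesgue_measure (A ord0) *
   \prod_(i < n) lebesgue_measure (A (lift ord0 i)))%E).
have -> : @rV_cons R n @^-1` [set x | forall i, A i (x ord0 i)] =
    A ord0 `*` [set x : 'rV[R]_n | forall i : 'I_n, A (lift ord0 i) (x ord0 i)].
  apply/seteqP; split=> -[a v] /=.
    move=> Av; split => /= [|i].
      by have := Av ord0; rewrite mxE unlift_none.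
    by have := Av (lift ord0 i); rewrite mxE liftK.
  move=> [/= Aa Av] i; rewrite mxE /=.
  by case: (unliftP ord0 i) => [j|] ->.
have mA' (i : 'I_n) : measurable (A (lift ord0 i)) by exact: mA.
rewrite product_measure1E//; last exact: measurable_rV_box mA'.
by rewrite -(IH _ mA').
Qed.

(** A Lebesgue measurable function: preimages of Borel sets belong to the
    completion of the Borel sigma-algebra. *)
Definition lebesgue_measurable_fun (R : realType) (n : nat)
    (f : 'rV[R]_n -> R) : Prop :=
  forall B : set (measurableTypeR R), measurable B ->
    completed_algebra_gen (lebesgue_rV R n) (f @^-1` B).

Section sobolev.
Context {R : realType} {d : nat}.
Notation Rd := 'rV[R]_d.
Notation mu := (lebesgue_rV R d).
Implicit Types (u v g phi : Rd -> R) (i : 'I_d).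

Definition partial i phi : Rd -> R := fun x => 'D_(delta_mx ord0 i) phi x.

Definition partials (s : seq 'I_d) phi : Rd -> R := foldr partial phi s.

Definition smooth phi : Prop :=
  forall s : seq 'I_d, continuous (partials s phi) /\
    forall i x, derivable (partials s phi) x (delta_mx ord0 i).

Definition test_function phi : Prop :=
  smooth phi /\ compact (closure [set x | phi x != 0]).

Definition is_weak_partial i u g : Prop :=
  forall phi, test_function phi ->
    (\int[mu]_x (u x * partial i phi x)%:E =
     - \int[mu]_x (g x * phi x)%:E)%E.

(* An element of H^1 is represented by any of its Borel representatives. *)
Definition H1 : set (Rd -> R) :=
  [set u | u \in Lfun mu 2%:E /\
    forall i, exists2 g, g \in Lfun mu 2%:E & is_weak_partial i u g].

(* A representative, chosen in L^2, of the i-th weak partial derivative of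
   u in H^1; weak derivatives are unique up to a.e. equality. *)
Definition weak_partial i u : Rd -> R :=
  xget (cst 0) [set g | g \in Lfun mu 2%:E /\ is_weak_partial i u g].

Definition sqnorm_grad u (x : Rd) : R := \sum_(i < d) weak_partial i u x ^+ 2.

End sobolev.

(* f is C^1 on [0, +oo[ with derivative f', one-sided at 0. The values of f
   outside [0, +oo[ are irrelevant. *)
Definition C1_nneg_with (R : realType) (f f' : R -> R) : Prop :=
  {within `[0, +oo[, continuous f'} /\
  forall s, 0 <= s ->
    (fun h => h^-1 * (f (s + h) - f s))
      @ within [set h | 0 <= s + h] 0^' --> f' s.

Definition concave_nneg (R : realType) (f : R -> R) : Prop :=
  forall s t a, 0 <= s -> 0 <= t -> 0 <= a <= 1 ->
    a * f s + (1 - a) * f t <= f (a * s + (1 - a) * t).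

Definition admissible_denominators (R : realType) (r : R -> R -> R) : Prop :=
  [/\ forall e, 0 < e ->
        [/\ exists2 r', C1_nneg_with (r e) r' & forall s, 0 <= s -> 0 <= r' s,
            forall s, 0 <= s -> 0 < r e s
          & concave_nneg (r e)],
      forall s, 0 <= s -> forall e1 e2, 0 < e1 -> e1 <= e2 ->
        s <= r e1 s <= r e2 s
    & forall s, 0 <= s -> r e s @[e --> 0^'+] --> s].

Definition preg (R : realType) (sigma s : R) : R :=
  Num.sqrt (s ^+ 2 + sigma ^+ 2) - sigma.

Section functional.
Context {R : realType} {d : nat}.
Notation Rd := 'rV[R]_d.
Notation mu := (lebesgue_rV R d).
Local Open Scope ereal_scope.

Definition admissible (V : Rd -> R) : set (Rd -> R) :=
  [set rho | [/\ H1 rho,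
                 {ae mu, forall x, (0 <= rho x)%R},
                 \int[mu]_x (rho x)%:E = 1
               & \int[mu]_x (V x * rho x)%:E < +oo]].

(* For rho in [admissible V] the integrand is a.e. nonnegative and a.e. equal to
   a Borel function, so this is its usual Lebesgue integral, even if V is only
   Lebesgue measurable. The energy is finite there, since r >= r 0 > 0 and
   preg sigma s <= s on [0, +oo[. *)
Definition energy (r : R -> R) (V : Rd -> R) (sigma beta delta : R)
    (rho : Rd -> R) : \bar R :=
  \int[mu]_x (sqnorm_grad rho x / (8 * r (rho x))
              + V x * preg sigma (rho x)
              + beta / 2 * rho x ^+ 2
              + delta / 2 * sqnorm_grad rho x)%:E.

Definition mix (a : R) (u v : Rd -> R) : Rd -> R :=
  fun x => (a * u x + (1 - a) * v x)%R.

(* Distinct elements of H^1 are functions that are not equal a.e. *)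
Definition strictly_convex_on (A : set (Rd -> R)) (F : (Rd -> R) -> \bar R) :=
  forall u v (a : R), A u -> A v -> ~ {ae mu, forall x, u x = v x} ->
    (0 < a < 1)%R ->
    F (mix a u v) < a%:E * F u + (1 - a)%:E * F v.

Definition strongly_convex_on (A : set (Rd -> R)) (F : (Rd -> R) -> \bar R)
    (N : (Rd -> R) -> \bar R) :=
  exists2 m : R, (0 < m)%R &
  forall u v (a : R), A u -> A v -> (0 <= a <= 1)%R ->
    F (mix a u v) <= a%:E * F u + (1 - a)%:E * F v
                     - (m / 2 * a * (1 - a))%:E * N (u \- v)%R ^+ 2.

Definition L2norm (u : Rd -> R) : \bar R := 'N[mu]_2%:E[EFin \o u].

End functional.

(* Main.v *)
(** The map (p, s) |-> p^2 / r(s) is jointly convex because r is positive and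
    concave, sqrt(s^2 + sigma^2) is convex, and the two quadratic terms satisfy
    the exact identity
      |a x + (1-a) y|^2 + a (1-a) |x - y|^2 = a |x|^2 + (1-a) |y|^2.
    Integrating the pointwise inequality, and using that weak gradients are
    a.e. unique (hence linear), the convexity defect of the energy is at least
      a (1-a) int (beta/2 |u - v|^2 + delta/2 |grad u - grad v|^2).
    This is strong convexity in L^2, with constant beta, when beta > 0.

    For strict convexity, suppose that w = u - v has zero weak gradient. For a
    product bump psi and its translate psi_L by L in a coordinate direction,
    psi - psi_L is the derivative in that direction of a test function, so
    int w psi = int w psi_L. As w is integrable and psi_L tends to 0 pointwise
    when L tends to infinity, int w psi = 0, whence w = 0 a.e. *)

From HB Require Import structures.
Require Import Defs.
From mathcomp Require Import all_boot all_order all_algebra.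
From mathcomp Require Import all_classical all_reals all_analysis.
From mathcomp Require Import measurable_realfun.
From mathcomp Require Import ring lra.
Set Implicit Arguments.
Unset Strict Implicit.
Unset Printing Implicit Defensive.
Import Order.TTheory GRing.Theory Num.Theory.
Import numFieldNormedType.Exports.
Local Open Scope ring_scope.
Local Open Scope classical_set_scope.

(** * Integrals modulo null sets *)

Section ae_integral.
Local Open Scope ereal_scope.
Context d (T : measurableType d) (R : realType).
Variable mu : {measure set T -> \bar R}.
Implicit Types f g : T -> \bar R.
Import HBNNSimple.

(* The integral of a nonnegative function that need not be measurable is the
   supremum of the integrals of the simple functions below it; restricting such
   a simple function to the complement of a null set keeps its integral. *)
Lemma le_integral_ae f g : (forall x, 0 <= f x) -> (forall x, 0 <= g x) ->
  {ae mu, forall x, f x <= g x} -> \int[mu]_x f x <= \int[mu]_x g x.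
Proof.
move=> f0 g0 [M [mM M0 fgM]].
rewrite (ge0_integralTE _ f0) (ge0_integralTE _ g0).
apply: ge_ereal_sup => _ [h hf <-].
apply: ereal_sup_ubound => /=.
have mCM : measurable (~` M) by exact: measurableC.
exists (proj_nnsfun h mCM).
  move=> x /=; rewrite mindicE; have [xM|xM] := boolP (x \in ~` M).
    rewrite mulr1 (le_trans (hf x))//.
    by apply: contrapT => /fgM; move: xM; rewrite inE.
  by rewrite mulr0.
rewrite -!integralT_nnsfun; apply: ae_eq_integral => //.
- exact/measurable_EFinP.
- exact/measurable_EFinP.
- exists M; split=> // x /= /not_implyP[_]; apply: contra_notP => xM.
  by rewrite mindicE mem_set ?mulr1.
Qed.

(** The previous comparison is applied both ways to positive and negative parts. No measurability is
    asked of [f] or [g], which lets the energy be rewritten when [V] is merely Lebesgue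
    measurable. *)
Lemma eq_integral_ae f g :
  {ae mu, forall x, f x = g x} -> \int[mu]_x f x = \int[mu]_x g x.
Proof.
move=> fg; rewrite integralE [RHS]integralE; congr (_ - _);
  apply/eqP; rewrite eq_le; apply/andP; split; apply: le_integral_ae => //;
  by apply: filterS fg => x fgx; rewrite /= ?funeposE ?funenegE fgx.
Qed.

(** A set of the completion is Borel up to a null set. The preimages of the half-lines []q, +oo[]
    with [q] rational involve countably many null sets, and setting [f] to 0 on their union makes it
    Borel. *)
Lemma completed_measurable_fun_ae (f : T -> R) :
  (forall B : set (measurableTypeR R), measurable B ->
     completed_algebra_gen mu (f @^-1` B)) ->
  exists2 f0 : T -> R, measurable_fun setT f0 & {ae mu, forall x, f x = f0 x}.
Proof.
move=> cf.
(* An enumeration of the rationals; a code of no rational is sent to 0. *)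
pose q n : R := ratr (odflt 0%R (unpickle n)).
have /choice[N HN] n : exists N : set T, [/\ measurable N, mu N = 0
    & measurable (f @^-1` `]q n, +oo[ `\` N)].
  have [A mA [M [N [mN N0 MN]] AM]] :=
    cf `]q n, +oo[%classic (measurable_itv _).
  exists N; split=> //; rewrite -AM.
  rewrite (_ : _ `\` _ = A `\` N); first exact: measurableD.
  by rewrite setDUl (_ : M `\` N = set0) ?setU0//; rewrite setD_eq0.
pose N' := \bigcup_n N n.
have mN' : measurable N' by apply: bigcupT_measurable => n; have [] := HN n.
have N'0 : mu.-negligible N'.
  apply: negligible_bigcup => n; have [mN N0 _] := HN n.
  by exists (N n); split.
exists (fun x => f x * \1_(~` N') x)%R; last first.
  case: N'0 => M [mM M0 N'M]; exists M; split=> //;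
    apply: subset_trans N'M => x /=.
  apply: contra_notP => xN'.
  by rewrite indicE mem_set ?mulr1.
apply: (measurability _ (RGenOInfty.measurableE R)) => // _ [_ [y ->] <-].
rewrite setTI.
(* The modified function is 0 on [N'], so [N'] lies in the preimage exactly when [y < 0]. *)
rewrite (_ : _ @^-1` _ = \bigcup_(n in [set n | (y <= q n)%R])
   ((f @^-1` `]q n, +oo[ `\` N n) `\` N') `|` (N' `&` [set x | (y < 0)%R])).
  apply: measurableU; last first.
    by apply: measurableI => //; case: (y < 0)%R; rewrite ?set_true ?set_false.
  rewrite bigcup_mkcond; apply: bigcupT_measurable => n; case: ifPn => // _.
  by apply: measurableD => //; have [] := HN n.
apply/seteqP; split=> x /=; rewrite !in_itv/= !andbT indicE.
- have [xN|xN] := boolP (x \in ~` N').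
    rewrite mulr1 => yfx; left.
    have [p] := rat_in_itvoo yfx; rewrite in_itv/= => /andP[yp pf].
    exists (pickle p); first by rewrite /q /= pickleK/= ltW.
    rewrite /q /= pickleK/=.
    split; last by move: xN; rewrite inE.
    split; first by rewrite in_itv/= andbT.
    by move: xN; rewrite inE => + Nx; apply; exists (pickle p).
  by rewrite mulr0 => y0; right; split=> //; move: xN;
    rewrite notin_setE /= => /contrapT.
- case=> [[n /= yq [[+ _] xN']]|[xN' y0]].
    by rewrite in_itv/= andbT mem_set// mulr1; exact: le_lt_trans.
  by rewrite memNset ?mulr0//=; apply/contrapT.
Qed.
End ae_integral.

(** * Test functions on R^d *)

(** The norm is the sup norm, so the cubes with rational centre and radius [1/(k+1)] are coordinate
    boxes. They form a countable family, and an open set is the union of those it contains. *)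
Lemma open_measurable_rV (R : realType) n (U : set 'rV[R]_n) :
  open U -> measurable U.
Proof.
move=> oU.
pose B (p : 'rV[rat]_n * nat) : set 'rV[R]_n :=
  [set x | forall i, ball (ratr (p.1 ord0 i) : R) p.2.+1%:R^-1 (x ord0 i)].
have mB p : measurable (B p).
  apply: (@measurable_rV_box R n (fun i => ball (ratr (p.1 ord0 i) : R) _)).
  by move=> i; exact: measurable_ball.
rewrite (_ : U = \bigcup_(k in [set: nat])
   oapp (fun p => if `[< B p `<=` U >] then B p else set0) set0 (unpickle k));
     last first.
  apply/seteqP; split=> [x Ux|x [k _]]; last first.
    case: unpickle => //= p; case: asboolP => // BU; exact: BU.
  have /nbhs_ballP[e /= e0 eU] := open_nbhs_nbhs (conj oU Ux).
  (* With radius below [e / 2], a cube containing [x] lies in the ball of radius [e] about [x]. *)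
  have [k ke] : exists k : nat, k.+1%:R^-1 < e / 2.
    have e20 : 0 < e / 2 by rewrite divr_gt0.
    exists (Num.truncn (e / 2)^-1); rewrite invf_plt ?posrE//.
    exact: truncnS_gt.
  have /choice[q Hq] (i : 'I_n) :
      exists q : rat, ball (x ord0 i) k.+1%:R^-1 (ratr q).
    have : x ord0 i - k.+1%:R^-1 < x ord0 i + k.+1%:R^-1.
      by rewrite ltrD2l gt0_cp// invr_gt0.
    move=> /rat_in_itvoo[q]; rewrite in_itv/= => qx; exists q.
    by rewrite /ball/= ltr_distlC.
  exists (pickle (\row_i q i, k)) => //; rewrite pickleK/= asboolT.
    by move=> i /=; rewrite mxE; exact/ball_sym.
  move=> y By; apply: eU; split => // i j; rewrite ord1.
  have := By j; rewrite /= mxE => qy.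
  apply: (@le_ball _ _ _ (k.+1%:R^-1 + k.+1%:R^-1)).
    by rewrite (splitr e) lerD// ltW.
  exact: ball_triangle (Hq j) qy.
apply: bigcupT_measurable => k; case: unpickle => //= p.
by case: ifPn.
Qed.

Lemma continuous_measurable_rV (R : realType) n (f : 'rV[R]_n -> R) :
  continuous f -> measurable_fun setT f.
Proof.
move=> /continuousP cf; apply: (measurability _ (RGenOpens.measurableE R)).
move=> _ [_ [a [b ->] <-]]; rewrite setTI.
by apply: open_measurable_rV; apply: cf.
Qed.

Section test_functions.
Context {R : realType} {d : nat}.
Notation Rd := 'rV[R]_d.
Notation mu := (lebesgue_rV R d).
Implicit Types (u v g phi : Rd -> R) (i : 'I_d).

Definition cube (M : R) : set Rd := [set x | forall i, `|x ord0 i| <= M].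

Lemma measurable_cube M : measurable (cube M).
Proof.
rewrite (_ : cube M = [set x | forall i, `[- M, M]%classic (x ord0 i)]).
  by apply: (@measurable_rV_box R d (fun=> `[- M, M]%classic)) => i;
    exact: measurable_itv.
by apply/seteqP; split=> x /= Mx i; have := Mx i; rewrite ?in_itv/= ler_norml.
Qed.

Lemma cube_fin M : (mu (cube M) < +oo)%E.
Proof.
rewrite (_ : cube M = [set x | forall i, `[- M, M]%classic (x ord0 i)]).
  rewrite (@lebesgue_rV_box R d (fun=> `[- M, M]%classic))//.
  set P := (X in (X < _)%E).
  suff : P \is a fin_num by rewrite fin_numElt => /andP[].
  apply: (big_ind (fun x : \bar R => x \is a fin_num)) => // [x y|i _];
    first exact: fin_numM.
  by rewrite lebesgue_measure_itv/=; case: ifPn.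
by apply/seteqP; split=> x /= Mx i; have := Mx i; rewrite ?in_itv/= ler_norml.
Qed.

Lemma bounded_cube_Lfun2 (f : Rd -> R) (M C : R) : measurable_fun setT f ->
  (forall x, `|f x| <= C) -> (forall x, f x != 0 -> cube M x) ->
  f \in Lfun mu 2%:E.
Proof.
move=> mf fC fM; apply/andP; split; rewrite inE//=.
rewrite /finite_norm unlock poweR_lty//.
rewrite (@le_lt_trans _ _ (\int[mu]_x (C ^+ 2 * \1_(cube M) x)%:E)%E)//.
  apply: ge0_le_integral => //=.
  - apply/measurable_EFinP.
    apply/(@measurableT_comp _ _ _ _ _ _ (fun x : R => x `^ 2)%R) => //.
    exact/measurableT_comp.
  - by apply/measurable_EFinP; apply: measurable_funM => //;
     apply: measurable_indic; exact: measurable_cube.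
  move=> x _; rewrite lee_fin indicE; have [xM|xM] := boolP (x \in cube M).
    rewrite mulr1 powR_mulrn// lerXn2r// ?nnegrE//.
    exact: le_trans (normr_ge0 _) (fC x).
  rewrite (_ : f x = 0) ?normr0 ?powR0 ?mulr0//.
  by apply/eqP; apply: contraNT xM => fx; rewrite inE; exact: fM.
under eq_integral do rewrite EFinM.
rewrite ge0_integralZl//; last 2 first.
- by apply/measurable_EFinP; apply: measurable_indic; exact: measurable_cube.
- by rewrite lee_fin sqr_ge0.
rewrite integral_indic//; last exact: measurable_cube.
by rewrite setIT lte_mul_pinfty ?lee_fin ?sqr_ge0 ?cube_fin.
Qed.

Lemma test_function_continuous phi : test_function phi -> continuous phi.
Proof. by move=> [/(_ [::])[]]. Qed.

Lemma test_function_cube phi : test_function phi ->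
  exists M, forall x, phi x != 0 -> cube M x.
Proof.
move=> [_ /compact_bounded[M [Mr HM]]].
exists (M + 1) => x px i.
have xM : `|x| <= M + 1.
  by apply: HM; rewrite ?ltrDl//; exact: subset_closure.
apply: le_trans xM.
rewrite [leRHS]/Num.Def.normr /= mx_normrE;
  exact: (le_bigmax _ (fun ij => `|x ij.1 ij.2|) (ord0, i)).
Qed.

Lemma test_function_bounded phi : test_function phi ->
  exists C, forall x, `|phi x| <= C.
Proof.
move=> tphi; have [_ cK] := tphi.
have : compact (phi @` closure [set x | phi x != 0]).
  by apply: continuous_compact => //; apply: continuous_subspaceT;
    exact: test_function_continuous.
move=> /compact_bounded[M [Mr HM]]; exists (Num.max 0 (M + 1)) => x.
have [->|px] := eqVneq (phi x) 0; first by rewrite normr0 le_max lexx.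
rewrite le_max; apply/orP; right; apply: HM; rewrite ?ltrDl//.
by exists x => //; exact: subset_closure.
Qed.

Lemma test_function_Lfun2 phi : test_function phi -> phi \in Lfun mu 2%:E.
Proof.
move=> tphi; have [M HM] := test_function_cube tphi.
have [C HC] := test_function_bounded tphi.
apply: bounded_cube_Lfun2 HC HM.
by apply: continuous_measurable_rV; exact: test_function_continuous.
Qed.

(** [partials] applies the last index first, so the derivatives of [partial i phi] are those of
    [phi] along [rcons s i]. Off its closed support [phi] vanishes locally, hence so does the
    derivative. *)
Lemma test_function_partial i phi : test_function phi ->
  test_function (partial i phi).
Proof.
move=> [sphi cphi]; split.
  move=> s; have := sphi (rcons s i).
  by rewrite /partials foldr_rcons.
apply: (subclosed_compact _ cphi); first exact: closed_closure.
have /closure_id KE := @closed_closure _ [set x | phi x != 0].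
rewrite [X in _ `<=` X]KE.
apply: closureS => x /=; apply: contra_neqP => xK.
have : nbhs x (~` closure [set x | phi x != 0]).
  by apply: open_nbhs_nbhs; split => //; apply: closed_openC;
    exact: closed_closure.
move=> nx; rewrite /partial (@near_eq_derive _ _ _ _ (cst 0)).
  by rewrite derive_cst.
apply: filterS nx => y; apply: contra_notP => /eqP yphi.
exact: subset_closure.
Qed.
End test_functions.

(** * Linearity in L^2 and of weak derivatives *)

Section Lfun_extra.
Context d (T : measurableType d) (R : realType).
Variable mu : {measure set T -> \bar R}.
Implicit Types f g h : T -> R.

Lemma Lfun_measurable p f : f \in Lfun mu p -> measurable_fun setT f.
Proof. by move=> /andP[]; rewrite inE. Qed.

Lemma Lfun2_lin a b f g : f \in Lfun mu 2%:E -> g \in Lfun mu 2%:E ->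
  (fun x => a * f x + b * g x) \in Lfun mu 2%:E.
Proof.
move=> f2 g2.
have p1 : (1 <= 2%:E :> \bar R)%E by rewrite lee1n.
have [L0 LD] := Lfun_submod_closed mu p1.
rewrite (_ : (fun x => _) = a *: f + (b *: g + 0)); last first.
  by apply/funext => x; rewrite !fctE addr0.
by apply: (LD) => //; exact: LD.
Qed.

Lemma Lfun2_mul_integrable f g : f \in Lfun mu 2%:E -> g \in Lfun mu 2%:E ->
  mu.-integrable setT (fun x => (f x * g x)%:E).
Proof. by move=> f2 g2; apply/Lfun1_integrable; exact: Lfun2_mul_Lfun1. Qed.

Lemma integral_lin_mul a b f g h : f \in Lfun mu 2%:E -> g \in Lfun mu 2%:E ->
  h \in Lfun mu 2%:E ->
  (\int[mu]_x ((a * f x + b * g x) * h x)%:E =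
   a%:E * \int[mu]_x (f x * h x)%:E + b%:E * \int[mu]_x (g x * h x)%:E)%E.
Proof.
move=> f2 g2 h2.
have fh := Lfun2_mul_integrable f2 h2.
have gh := Lfun2_mul_integrable g2 h2.
under eq_integral do rewrite mulrDl -2!mulrA EFinD !(EFinM a) !(EFinM b).
by rewrite integralD ?integralZl//; exact: integrableZl.
Qed.
End Lfun_extra.

Section weak_partial_lin.
Context {R : realType} {d : nat}.
Notation Rd := 'rV[R]_d.
Notation mu := (lebesgue_rV R d).
Implicit Types (u v g h phi : Rd -> R) (i : 'I_d).

Lemma is_weak_partial_lin i a b u v g h :
  u \in Lfun mu 2%:E -> v \in Lfun mu 2%:E ->
  g \in Lfun mu 2%:E -> h \in Lfun mu 2%:E ->
  is_weak_partial i u g -> is_weak_partial i v h ->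
  is_weak_partial i (fun x => a * u x + b * v x) (fun x => a * g x + b * h x).
Proof.
move=> u2 v2 g2 h2 ug vh phi tphi.
have p2 := test_function_Lfun2 tphi.
have dp2 := test_function_Lfun2 (test_function_partial i tphi).
rewrite !integral_lin_mul// ug// vh//.
have fg : (\int[mu]_x (g x * phi x)%:E \is a fin_num)%E.
  exact/integrable_fin_num/Lfun2_mul_integrable.
have fh : (\int[mu]_x (h x * phi x)%:E \is a fin_num)%E.
  exact/integrable_fin_num/Lfun2_mul_integrable.
rewrite -(fineK fg) -(fineK fh) -!EFinN -!EFinM -!EFinD -?EFinN; congr EFin.
by rewrite !mulrN opprD.
Qed.

Lemma H1_Lfun2 u : H1 u -> u \in Lfun mu 2%:E.
Proof. by case. Qed.

Lemma weak_partialP i u : H1 u ->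
  weak_partial i u \in Lfun mu 2%:E /\ is_weak_partial i u (weak_partial i u).
Proof.
move=> [_ /(_ i)[g g2 ug]].
pose P : set (Rd -> R) := [set g | g \in Lfun mu 2%:E /\ is_weak_partial i u g].
have : P (weak_partial i u) by apply: (@xgetPex _ (cst 0) P); exists g.
by [].
Qed.

Lemma H1_lin a b u v : H1 u -> H1 v -> H1 (fun x => a * u x + b * v x).
Proof.
move=> Hu Hv; split=> [|i]; first exact: Lfun2_lin (H1_Lfun2 Hu) (H1_Lfun2 Hv).
have [gu ug] := weak_partialP i Hu; have [gv vg] := weak_partialP i Hv.
exists (fun x => a * weak_partial i u x + b * weak_partial i v x).
  exact: Lfun2_lin.
by apply: is_weak_partial_lin => //; exact: H1_Lfun2.
Qed.
End weak_partial_lin.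

(** * Smooth bumps *)

Section flat_exponential.
Context {R : realType}.
Implicit Types (s : R) (k : nat).

(* The powers s^-k make this family of extensions by 0 of exp(-1/s) stable
   under differentiation, up to linear combinations. *)
Definition flat_exp k s : R := if 0 < s then s^-1 ^+ k * expR (- s^-1) else 0.

Lemma flat_exp_le0 k s : s <= 0 -> flat_exp k s = 0.
Proof. by move=> s0; rewrite /flat_exp ltNge s0. Qed.

Lemma flat_exp_ge0 k s : 0 <= flat_exp k s.
Proof.
rewrite /flat_exp; case: ifPn => // s0.
by rewrite mulr_ge0 ?expR_ge0// exprn_ge0// invr_ge0 ltW.
Qed.

(** This follows from [1 + y^(k+2) / (k+2)! <= expR y] at [y = 1/s]. The left side is the size of
    the difference quotient at 0, which therefore tends to 0. *)
Lemma flat_exp_bound k s : `|s^-1 * flat_exp k s| <= k.+2`!%:R * `|s|.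
Proof.
rewrite /flat_exp; case: ifPn => [s0|_]; last by rewrite mulr0 normr0 mulr_ge0.
have i0 : 0 < s^-1 by rewrite invr_gt0.
rewrite !ger0_norm ?mulr_ge0 ?expR_ge0 ?exprn_ge0 ?(ltW i0) ?(ltW s0)//.
have H := @expR_ge1Dxn R s^-1 k.+1 (ltW i0).
have {}H : s^-1 ^+ k.+2 <= k.+2`!%:R * expR s^-1.
  rewrite -ler_pdivrMl ?ltr0n ?fact_gt0// mulrC; apply: le_trans H.
  by rewrite lerDr.
rewrite expRN.
have -> : s^-1 * (s^-1 ^+ k * (expR s^-1)^-1) =
    s^-1 ^+ k.+2 * ((expR s^-1)^-1 * s).
  rewrite !exprS; field.
  by rewrite !lt0r_neq0// expR_gt0.
rewrite [X in _ <= _ * X](_ : s = expR s^-1 * ((expR s^-1)^-1 * s)); last first.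
  by rewrite mulrA mulfV ?mul1r// gt_eqF// expR_gt0.
by rewrite [leRHS]mulrA ler_wpM2r// mulr_ge0// ?invr_ge0 ?expR_ge0// ltW.
Qed.

Lemma is_derive_flat_exp k s :
  is_derive s 1 (flat_exp k) (- k%:R * flat_exp k.+1 s + flat_exp k.+2 s).
Proof.
have [s0|s0|->] := ltgtP s 0.
- rewrite !flat_exp_le0 ?ltW// mulr0 addr0.
  apply: (@near_eq_is_derive _ _ _ (cst 0)) => //.
    by near=> x; rewrite flat_exp_le0//; near: x; exact: lt_le_nbhsl.
- have sn0 : s != 0 by rewrite gt_eqF.
  apply: (@near_eq_is_derive _ _ _ (fun x : R => x^-1 ^+ k * expR (- x^-1))).
    by near=> x; rewrite /flat_exp ifT//; near: x; exact: lt_nbhsr.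
  have dV := @is_deriveV R id s 1 1 sn0 (is_derive_id s 1).
  have dE :
    is_derive s 1 (expR \o (fun x : R => - x^-1))
      (expR (- s^-1) * - (- s ^- 2 *: 1)).
    exact: is_derive1_comp.
  have dX := @is_deriveX _ _ _ k s 1 _ dV.
  have dM := is_deriveM dX dE.
  rewrite (_ : (fun x => _) =
    (fun y : R => (id y)^-1) ^+ k * (expR \o (fun x : R => - x^-1))); last first.
    by apply/funext => x /=; rewrite !fctE.
  apply: (is_derive_eq dM).
  rewrite /flat_exp s0.
  rewrite !fctE /GRing.scale/= -exprVn.
  move: (expR (- s^-1)) (s^-1) => e y.
  by case: (k) => [|m] /=; rewrite !exprS ?expr0; ring.
(* At 0 the difference quotient is squeezed between 0 and a multiple of [|h|]. *)
- rewrite !flat_exp_le0// mulr0 addr0.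
  have H : (fun h : R => h^-1 *: (flat_exp k (h *: 1 + 0) - flat_exp k 0))
      @ 0^' --> (0 : R).
    apply/norm_cvg0P.
    have B (h : R) : `|h^-1 *: (flat_exp k (h *: 1 + 0) - flat_exp k 0)| <=
        k.+2`!%:R * `|h|.
      rewrite [flat_exp k 0]flat_exp_le0// subr0 addr0.
      rewrite (_ : h *: 1 = h); last exact: mulr1.
      exact: flat_exp_bound.
    apply: (@squeeze_cvgr _ _ _ _ (cst 0) (fun h => k.+2`!%:R * `|h|)).
    - by near=> h; rewrite normr_ge0 B.
    - exact: cvg_cst.
    - rewrite -[X in _ --> X](mulr0 k.+2`!%:R).
      apply: cvgM; first exact: cvg_cst.
      by apply/norm_cvg0P; exact: nbhs_dnbhs.
  apply: DeriveDef.
    by apply/cvg_ex; exists 0.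
  by rewrite /derive; apply/cvg_lim.
Unshelve. all: by end_near.
Qed.
End flat_exponential.

(** * Smooth functions of one variable *)

Section smooth1.
Context {R : realType}.
Implicit Types (f g : R -> R).

Definition smooth1 f := forall n (x : R), derivable f^`(n) x 1.

(** Iterated derivatives never leave [S]. Smoothness thus reduces to finding a class stable under
    one differentiation, with no formula for higher derivatives. *)
Lemma smooth1_coind (S : (R -> R) -> Prop) :
  (forall f, S f -> exists2 g, S g & forall x : R, is_derive x 1 f (g x)) ->
  forall f, S f -> smooth1 f.
Proof.
move=> SD f Sf.
have SDn n : S f^`(n).
  elim: n => [|n /SD[g Sg Dg]]; first by rewrite derive1n0.
  rewrite derive1nS (_ : _^`() = g)//; apply/funext => x.
  by rewrite derive1E; have [_ ->] := Dg x.
by move=> n x; have [g _ Dg] := SD _ (SDn n); have [] := Dg x.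
Qed.

Lemma smooth1_derive f : smooth1 f -> smooth1 f^`().
Proof. by move=> sf n x; rewrite -derive1Sn; exact: sf. Qed.

Lemma smooth1_primitive f g : (forall x : R, is_derive x 1 f (g x)) ->
  smooth1 g -> smooth1 f.
Proof.
move=> Df sg; have f'E : f^`() = g.
  by apply/funext => x; rewrite derive1E; have [_ ->] := Df x.
case=> [|n] x; first by rewrite derive1n0; have [] := Df x.
by rewrite derive1Sn f'E.
Qed.

Lemma smooth1_is_derive f (x : R) : smooth1 f -> is_derive x 1 f (f^`() x).
Proof. by move=> sf; rewrite derive1E; apply: derivableP; exact: (sf 0%N). Qed.

Lemma smooth1B f g : smooth1 f -> smooth1 g -> smooth1 (f \- g).
Proof.
move=> sf sg.
apply: (@smooth1_coind (fun h =>
  exists f g, [/\ smooth1 f, smooth1 g & h = f \- g])).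
  move=> _ [{}f [{}g [{}sf {}sg ->]]]; exists (f^`() \- g^`()).
    by exists f^`(), g^`(); split;
      [exact: smooth1_derive|exact: smooth1_derive|].
  move=> x; have Df := smooth1_is_derive x sf.
  have Dg := smooth1_is_derive x sg.
  exact: is_deriveB.
by exists f, g.
Qed.

Lemma smooth1_shift f c : smooth1 f -> smooth1 (fun t => f (t - c)).
Proof.
move=> sf.
apply: (@smooth1_coind (fun h =>
  exists2 f, smooth1 f & h = (fun t => f (t - c)))).
  move=> _ [{}f {}sf ->]; exists (fun t => f^`() (t - c)).
    by exists f^`(); [exact: smooth1_derive|].
  move=> x; have Df := smooth1_is_derive (x - c) sf.
  have Ds : is_derive x 1 (fun t => t - c) 1.
    by apply: is_derive_eq; rewrite subr0.
  have D := @is_derive1_comp R f (fun t => t - c) x _ _ Df Ds.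
  by rewrite mulr1 in D.
by exists f.
Qed.

Lemma smooth1_continuous f : smooth1 f -> continuous f.
Proof.
move=> sf x; apply: differentiable_continuous; apply/derivable1_diffP.
exact: (sf 0%N).
Qed.

Variables (a c l : R).

(** The linear span of products of two flat exponentials; the product rule keeps derivatives inside
    it, as [smooth1_coind] requires. *)
Inductive bump_span : (R -> R) -> Prop :=
| bump_span_base k m :
    bump_span (fun t => flat_exp k (l * (t - a)) * flat_exp m (l * (c - t)))
| bump_spanD f g : bump_span f -> bump_span g -> bump_span (fun t => f t + g t)
| bump_spanZ r f : bump_span f -> bump_span (fun t => r * f t).

Lemma bump_span_derive f : bump_span f ->
  exists2 g, bump_span g & forall x : R, is_derive x 1 f (g x).
Proof.
elim=> {f} [k m|f g _ [f' Sf Df] _ [g' Sg Dg]|r f _ [f' Sf Df]].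
- pose F k t := flat_exp k (l * (t - a));
  pose G k t := flat_exp k (l * (c - t)).
  exists (fun t => (l * (- k%:R) * (F k.+1 t * G m t) + l * (F k.+2 t * G m t))
    + (l * m%:R * (F k t * G m.+1 t) + (- l) * (F k t * G m.+2 t))).
    by do ![apply: bump_spanD|apply: bump_spanZ]; exact: bump_span_base.
  move=> x.
  have DF : is_derive x 1 (F k) ((- k%:R * F k.+1 x + F k.+2 x) * l).
    have D1 : is_derive x 1 (fun t => l * (t - a)) l.
      by apply: is_derive_eq; rewrite subr0 /GRing.scale/= !(mulr1,mulr0,addr0).
    exact: (@is_derive1_comp R (flat_exp k) (fun t => l * (t - a)) x _ _
      (is_derive_flat_exp k (l * (x - a))) D1).
  have DG : is_derive x 1 (G m) ((- m%:R * G m.+1 x + G m.+2 x) * - l).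
    have D1 : is_derive x 1 (fun t => l * (c - t)) (- l).
      by apply: is_derive_eq; rewrite add0r /GRing.scale/= mul1r mulrN1.
    exact: (@is_derive1_comp R (flat_exp m) (fun t => l * (c - t)) x _ _
      (is_derive_flat_exp m (l * (c - x))) D1).
  apply: (is_derive_eq (is_deriveM DF DG)).
  by rewrite /GRing.scale/=; ring.
- exists (fun t => f' t + g' t); first exact: bump_spanD.
  by move=> x; have D1 := Df x; have D2 := Dg x; exact: is_deriveD.
- exists (fun t => r * f' t); first exact: bump_spanZ.
  by move=> x; have D1 := Df x; apply: (is_derive_eq (is_deriveZ r D1)).
Qed.

(** For [l > 0], a smooth bump that is positive exactly on []a, c[]; [l] governs its steepness. *)
Definition bump t : R := flat_exp 0 (l * (t - a)) * flat_exp 0 (l * (c - t)).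

Lemma smooth1_bump : smooth1 bump.
Proof. by apply: (smooth1_coind bump_span_derive); exact: bump_span_base. Qed.

Lemma flat_exp0_le1 (s : R) : flat_exp 0 s <= 1.
Proof.
rewrite /flat_exp; case: ifPn => // s0.
by rewrite expr0 mul1r expR_le1 oppr_le0 invr_ge0 ltW.
Qed.

Lemma bump_ge0 t : 0 <= bump t.
Proof. by rewrite mulr_ge0 ?flat_exp_ge0. Qed.

Lemma bump_le1 t : bump t <= 1.
Proof. by rewrite mulr_ile1 ?flat_exp_ge0 ?flat_exp0_le1. Qed.

Lemma bump_supp t : 0 < l -> bump t != 0 -> a < t < c.
Proof.
move=> l0; rewrite mulf_eq0 negb_or => /andP[H1 H2]; apply/andP; split.
  rewrite -subr_gt0 -(pmulr_rgt0 _ l0) ltNge; apply: contra H1 => ?.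
  by rewrite flat_exp_le0.
rewrite -subr_gt0 -(pmulr_rgt0 _ l0) ltNge; apply: contra H2 => ?.
by rewrite flat_exp_le0.
Qed.
End smooth1.

(** Inside []a, c[] each factor has the form [exp(-1/((n+1)s))] with [s > 0] and tends to 1;
    outside, every bump vanishes. *)
Lemma cvg_bump {R : realType} (a c t : R) :
  bump a c n.+1%:R t @[n --> \oo] --> (\1_(`]a, c[) t : R).
Proof.
have cvgE (s : R) : 0 < s -> flat_exp 0 (n.+1%:R * s) @[n --> \oo] --> (1 : R).
  move=> s0.
  rewrite (_ : (fun n => _) = (fun n => expR (- (n.+1%:R^-1 * s^-1))));
    last first.
    by apply/funext => n; rewrite /flat_exp pmulr_rgt0// s0 expr0 mul1r invfM.
  rewrite -[X in _ --> X](@expR0 R).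
  apply: continuous_cvg; first exact: continuous_expR.
  rewrite -[X in _ --> X]oppr0 -[X in _ --> - X](mul0r s^-1).
  apply: cvgN; apply: cvgM; [exact: cvg_harmonic|exact: cvg_cst].
rewrite indicE; have [|tac] := boolP (t \in _).
  rewrite inE/= in_itv/= => /andP[act tc].
  by rewrite -[X in _ --> X](mulr1 1); apply: cvgM; apply: cvgE;
    rewrite subr_gt0.
rewrite (_ : (fun n => _) = cst 0); first exact: cvg_cst.
apply/funext => n /=; apply/eqP; apply: contraNT tac => /bump_supp.
by rewrite inE/= in_itv/=; apply.
Qed.

(* The primitive starts from -oo; it is eventually constant, so its difference
   with a translate is compactly supported. *)
Lemma compact_primitive {R : realType} (a c : R) (b : R -> R) :
  continuous b -> (forall t, b t != 0 -> a < t < c) ->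
  exists B : R -> R, [/\ forall x : R, is_derive x 1 B (b x),
    forall t, t <= a -> B t = 0 & forall t, c <= t -> B t = B c].
Proof.
move=> cb sb.
have b0 t : ~~ (a < t < c) -> b t = 0.
  by move=> H; apply/eqP; apply: contraNT H => /sb.
have intb : (@lebesgue_measure R).-integrable setT (EFin \o b).
  rewrite (_ : EFin \o b = (EFin \o b) \_ `[a, c]).
    have := @continuous_compact_integrable R b `[a, c] (@segment_compact R a c)
      (continuous_subspaceT cb).
    by have [+ _] := integrable_mkcond (mu := @lebesgue_measure R) (EFin \o b)
      (measurable_itv `[a, c]%R); apply.
  apply/funext => t; rewrite patchE; case: ifPn => //= tac.
  rewrite b0//; apply: contra tac => /andP[/ltW at_ /ltW tc].
  by rewrite inE/= in_itv/= at_ tc.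
pose B x :=
  (\int[@lebesgue_measure R]_(t in [set` Interval -oo%O (BRight x)]) (b t))%R.
(* Over a fixed domain, two values of [B] can be compared through their integrands. *)
have BE t :
  B t = (\int[@lebesgue_measure R]_t' (if t' <= t then b t' else 0))%R.
  rewrite /B Rintegral_mkcond; congr Rintegral; apply/funext => s.
  by rewrite patchE mem_setE in_itv/=.
exists B; split.
(* The domain is prolonged to [x + 1] to make [x] an interior point. *)
- move=> x; have xx1 : x < x + 1 by rewrite ltrDl.
  have I : (@lebesgue_measure R).-integrable
    [set` Interval -oo%O (BRight (x + 1))] (EFin \o b).
    by apply: integrableS intb.
  have [d1 d2] := continuous_FTC1 xx1 I (ltNyr x) (cb x).
  by rewrite -d2 derive1E; exact: derivableP.
- move=> t ta; rewrite BE (_ : (fun t' => _) = cst 0) ?Rintegral_cst ?mul0r//.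
  apply/funext => s /=; case: ifPn => // st; apply: b0.
  by rewrite ltNge (le_trans st ta).
- move=> t ct; rewrite !BE; congr Rintegral; apply/funext => s.
  have [sc|cs] := leP s c; first by rewrite (le_trans sc ct).
  by case: ifPn => // _; apply: b0; rewrite negb_and -!leNgt (ltW cs) orbT.
Qed.

(** * Product test functions *)

Section product_test.
Context {R : realType} {d : nat}.
Notation Rd := 'rV[R]_d.
Implicit Types (f : 'I_d -> R -> R) (i j : 'I_d).

Definition prod_fun f (x : Rd) : R := \prod_i f i (x ord0 i).

Lemma prod_fun_continuous f : (forall i, continuous (f i)) ->
  continuous (prod_fun f).
Proof.
move=> cf.
suff cs (s : seq 'I_d) :
  continuous (fun x : Rd => \prod_(i <- s) f i (x ord0 i)).
  exact: cs.
elim: s => [|i s IH].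
  have -> : (fun x : Rd => \prod_(i <- [::]) f i (x ord0 i)) = cst 1.
    by apply/funext => y; rewrite big_nil.
  exact: cst_continuous.
have -> : (fun x : Rd => \prod_(j <- i :: s) f j (x ord0 j)) =
    (fun x => f i (x ord0 i) * \prod_(j <- s) f j (x ord0 j)).
  by apply/funext => y; rewrite big_cons.
move=> x; have h : {for x, continuous (f i \o (fun x : Rd => x ord0 i))}.
  apply: (@continuous_comp _ _ _ (fun x : Rd => x ord0 i) (f i)).
    exact: coord_continuous.
  exact: cf.
exact: (cvgM h (IH x)).
Qed.

Definition derive_at j f i : R -> R := if i == j then (f i)^`() else f i.

(** Along the [j]-th direction only the [j]-th factor varies, so the product is a one-variable
    function times the constant [C]. *)
Lemma prod_fun_is_derive j f x : (forall i, smooth1 (f i)) ->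
  is_derive x (delta_mx ord0 j) (prod_fun f) (prod_fun (derive_at j f) x).
Proof.
move=> sf.
pose C := \prod_(i | i != j) f i (x ord0 i).
have E h : prod_fun f (h *: delta_mx ord0 j + x) = f j (h *: 1 + x ord0 j) * C.
  rewrite /prod_fun (bigD1 j)//= !mxE !eqxx/=; congr (_ * _).
  by apply: eq_bigr => i ij; rewrite !mxE eqxx/= (negbTE ij) mulr0 add0r.
have D : prod_fun (derive_at j f) x = (f j)^`()%classic (x ord0 j) * C.
  rewrite /prod_fun (bigD1 j)//= /derive_at eqxx; congr (_ * _).
  by apply: eq_bigr => i ij; rewrite (negbTE ij).
have [d1 d2] := smooth1_is_derive (x ord0 j) (sf j).
have H : (fun h : R =>
  h^-1 *: (prod_fun f (h *: delta_mx ord0 j + x) - prod_fun f x)) @ 0^' -->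
    prod_fun (derive_at j f) x.
  rewrite D -d2.
  rewrite (_ :
    (fun h => _) =
      (fun h => h^-1 *: (f j (h *: 1 + x ord0 j) - f j (x ord0 j)) * C)).
    by apply: cvgM; [exact: d1|exact: cvg_cst].
  apply/funext => h;
    rewrite E -[prod_fun f x](_ : prod_fun f (0 *: delta_mx ord0 j + x) = _).
    by rewrite E scale0r add0r -mulrBl scalerAl.
  by rewrite scale0r add0r.
apply: DeriveDef; last by rewrite /derive; apply/cvg_lim.
by apply/cvg_ex; eexists; exact: H.
Qed.

Lemma partial_prod_fun j f : (forall i, smooth1 (f i)) ->
  partial j (prod_fun f) = prod_fun (derive_at j f).
Proof.
by move=> sf; apply/funext => x; have [_] := prod_fun_is_derive j x sf.
Qed.

Lemma smooth1_derive_at j f : (forall i, smooth1 (f i)) ->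
  forall i, smooth1 (derive_at j f i).
Proof.
move=> sf i; rewrite /derive_at; case: ifP => // _; exact: smooth1_derive.
Qed.

(** Products of smooth one-variable functions are stable under every partial derivative, which gives
    smoothness. The support lies in the compact cube of half-side [M]. *)
Lemma test_function_prod f M : (forall i, smooth1 (f i)) ->
  (forall i t, f i t != 0 -> `|t| <= M) -> test_function (prod_fun f).
Proof.
move=> sf fM; split.
  move=> s; suff [g sg ->] : exists2 g, forall i, smooth1 (g i) &
      partials s (prod_fun f) = prod_fun g.
    split; first by apply: prod_fun_continuous => i; exact: smooth1_continuous.
    by move=> i x; have [] := prod_fun_is_derive i x sg.
  elim: s => [|j s [g sg IH]]; first by exists f.
  exists (derive_at j g); first exact: smooth1_derive_at.
  by rewrite /partials/= -/(partials s _) IH partial_prod_fun.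
have cK : compact [set x : Rd | forall i, `[- M, M]%classic (x ord0 i)].
  by apply: (@rV_compact R d (fun=> `[- M, M]%classic)) => _;
    exact: segment_compact.
apply: (subclosed_compact _ cK); first exact: closed_closure.
have /closure_id -> :
  closed [set x : Rd | forall i, `[- M, M]%classic (x ord0 i)].
  by apply: compact_closed => //; exact: norm_hausdorff.
apply: closureS => x /= px i; rewrite in_itv/= -ler_norml; apply: (fM i).
by apply: contra_neq px => fi0; rewrite /prod_fun (bigD1 i)//= fi0 mul0r.
Qed.
End product_test.

(** * The fundamental lemma of the calculus of variations *)

Section density_measure.
Local Open Scope ereal_scope.
Context dp (T : measurableType dp) (R : realType).
Variables (mu : {measure set T -> \bar R}) (f : T -> R).
Hypotheses (mf : measurable_fun setT f) (f0 : forall x, (0 <= f x)%R).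

Definition density : set T -> \bar R := fun A => \int[mu]_(x in A) (f x)%:E.

Let density_set0 : density set0 = 0.
Proof. by rewrite /density integral_set0. Qed.

Let density_ge0 A : 0 <= density A.
Proof. by apply: integral_ge0 => x _; rewrite lee_fin. Qed.

Let density_sigma_additive : semi_sigma_additive density.
Proof.
apply: semi_sigma_additive_nng_induced => [|x]; last by rewrite lee_fin.
exact/measurable_EFinP.
Qed.

(** Seen as measures, two densities with equal integrals over boxes can be compared by uniqueness on
    a pi-system. *)
Definition density_measure : {measure set T -> \bar R} :=
  HB.pack_for {measure set T -> \bar R} density
    (isMeasure.Build _ _ _ density density_set0 density_ge0
      density_sigma_additive).

Lemma density_measureE A : density_measure A = \int[mu]_(x in A) (f x)%:E.
Proof. by []. Qed.
End density_measure.

(** * Open boxes as a generating pi-system *)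

Section open_box.
Context {R : realType} {d : nat}.
Notation Rd := 'rV[R]_d.
Implicit Types a c : 'I_d -> R.

Definition open_box a c : set Rd :=
  [set x | forall i, `]a i, c i[%classic (x ord0 i)].

Definition open_boxes : set (set Rd) := [set A | exists a c, A = open_box a c].

Lemma measurable_open_box a c : measurable (open_box a c).
Proof.
by apply: (@measurable_rV_box R d (fun i => `]a i, c i[%classic)) => i;
  exact: measurable_itv.
Qed.

Lemma open_boxes_setI : setI_closed open_boxes.
Proof.
move=> _ _ [a [c ->]] [a' [c' ->]].
exists (fun i => Num.max (a i) (a' i)), (fun i => Num.min (c i) (c' i)).
apply/seteqP; split=> x /=.
  move=> [H1 H2] i; move: (H1 i) (H2 i); rewrite /= !in_itv/= gt_max lt_min.
  by move=> /andP[-> ->] /andP[-> ->].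
by move=> H; split=> i; move: (H i); rewrite /= !in_itv/= gt_max lt_min =>
  /andP[/andP[H1 H2] /andP[H3 H4]]; rewrite ?H1 ?H2 ?H3 ?H4.
Qed.

Definition big_box k : set Rd := open_box (fun=> - k%:R) (fun=> k%:R).

Lemma big_box_cover (x : Rd) : exists k, forall m, (k <= m)%N -> big_box m x.
Proof.
exists (Num.truncn `|x|).+1 => m km i /=; rewrite in_itv/= -ltr_norml.
apply: le_lt_trans (_ : `|x| < _).
  rewrite [leRHS]/Num.Def.normr /= mx_normrE.
  exact: (le_bigmax _ (fun ij => `|x ij.1 ij.2|) (ord0, i)).
by apply: lt_le_trans (truncnS_gt _) _; rewrite ler_nat.
Qed.

Lemma bigcup_big_box : \bigcup_k big_box k = [set: Rd].
Proof.
apply/seteqP; split=> // x _; have [k Hk] := big_box_cover x.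
by exists k => //; exact: Hk.
Qed.

(** The preimage of an open interval by a coordinate is the union over [k] of the boxes whose other
    sides are []-k, k[], so coordinates are measurable for the sigma-algebra of open boxes. *)
Lemma measurable_rV_open_boxes : @measurable _ Rd = <<s open_boxes >>.
Proof.
apply/seteqP; split; last first.
  apply: smallest_sub; first exact: sigma_algebra_measurable.
  by move=> _ [a [c ->]]; exact: measurable_open_box.
pose T' := g_sigma_algebraType open_boxes.
have mcoord (i : 'I_d) :
  measurable_fun [set: T'] (fun x : T' => (x : Rd) ord0 i : measurableTypeR R).
  apply: (measurability _ (RGenOpens.measurableE R)).
  move=> _ [_ [y [z ->] <-]]; rewrite setTI.
  rewrite (_ : _ @^-1` _ = \bigcup_k open_box
     (fun j => if j == i then y else - k%:R) (fun j =>
       if j == i then z else k%:R)).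
    by apply: bigcupT_measurable => k; apply: sub_sigma_algebra; eexists;
      eexists.
  apply/seteqP; split => x /=.
    move=> xyz; have [k /(_ k (leqnn k)) Hk] := big_box_cover x;
      exists k => // j.
    by case: eqP => [->//|_]; exact: Hk.
  by move=> [k _ /(_ i)]; rewrite eqxx.
apply: smallest_sub; first exact: smallest_sigma_algebra.
rewrite -bigcup_seq => A [i _ [B mB <-]].
exact: mcoord.
Qed.
End open_box.

Section fundamental_lemma.
Context {R : realType} {d : nat}.
Notation Rd := 'rV[R]_d.
Notation mu := (lebesgue_rV R d).
Implicit Types (a c : 'I_d -> R) (h : Rd -> R).

Definition bump_box a c l : 'I_d -> R -> R := fun i => bump (a i) (c i) l.

Lemma smooth1_bump_box a c l i : smooth1 (bump_box a c l i).
Proof. exact: smooth1_bump. Qed.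

Lemma open_box_cube a c : exists M, forall i t, a i < t < c i -> `|t| <= M.
Proof.
exists (\sum_i (`|a i| + `|c i|)) => i t /andP[at_ tc].
rewrite (bigD1 i)//=; apply: (@le_trans _ _ (`|a i| + `|c i|)); last first.
  by rewrite lerDl sumr_ge0.
rewrite ler_norml; apply/andP; split.
  by have := ler_norm (- a i); rewrite normrN; have := normr_ge0 (c i); lra.
by have := ler_norm (c i); have := normr_ge0 (a i); lra.
Qed.

Lemma bump_box_test a c l : 0 < l -> test_function (prod_fun (bump_box a c l)).
Proof.
move=> l0; have [M HM] := open_box_cube a c.
apply: (@test_function_prod _ _ _ M) => i; first exact: smooth1_bump_box.
by move=> t /(bump_supp l0); exact: HM.
Qed.

Lemma prod_fun_ge0 (f : 'I_d -> R -> R) x : (forall i t, 0 <= f i t) ->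
  0 <= prod_fun f x.
Proof. by move=> f0; rewrite /prod_fun prodr_ge0. Qed.

Lemma prod_fun_le1 (f : 'I_d -> R -> R) x : (forall i t, 0 <= f i t <= 1) ->
  prod_fun f x <= 1.
Proof. by move=> f0; rewrite /prod_fun prodr_ile1. Qed.

(** The indicator of a box is the product of the indicators of its sides, and convergence holds
    factor by factor. *)
Lemma cvg_bump_box a c (x : Rd) :
  prod_fun (bump_box a c n.+1%:R) x @[n --> \oo] --> (\1_(open_box a c) x : R).
Proof.
have -> : \1_(open_box a c) x = \prod_i (\1_(`]a i, c i[) (x ord0 i) : R).
  rewrite indicE; have [|xac] := boolP (x \in open_box a c).
    rewrite inE => xac; rewrite big1// => i _.
    by rewrite indicE mem_set//; exact: xac.
  have /existsP[i xi] : [exists i, x ord0 i \notin `]a i, c i[%classic].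
    apply: contraNT xac; rewrite negb_exists => /forallP H.
    by rewrite inE => i; have := H i; rewrite negbK inE.
  by rewrite (bigD1 i)//= indicE (negbTE xi) mul0r.
rewrite /prod_fun; elim: (index_enum _) => [|i s IH].
  rewrite big_nil (_ : (fun n => _) = cst 1); first exact: cvg_cst.
  by apply/funext => n; rewrite big_nil.
rewrite big_cons (_ :
  (fun n => _) = (fun n => bump_box a c n.+1%:R i (x ord0 i) *
  \prod_(i0 <- s) bump_box a c n.+1%:R i0 (x ord0 i0))).
  by apply: cvgM; [exact: cvg_bump|exact: IH].
by apply/funext => n; rewrite big_cons.
Qed.

Lemma Lfun2_integrable_box h a c : h \in Lfun mu 2%:E ->
  mu.-integrable setT (fun x => (h x * \1_(open_box a c) x)%:E).
Proof.
move=> h2; apply: Lfun2_mul_integrable => //.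
have [M HM] := open_box_cube a c.
apply: (@bounded_cube_Lfun2 R d _ M 1).
- by apply: measurable_indic; exact: measurable_open_box.
- by move=> x; rewrite indicE; case: (_ \in _); rewrite ?normr1 ?normr0.
- move=> x; rewrite indicE; have [|_] := boolP (_ \in _); last by rewrite eqxx.
    by rewrite inE => xac _ i; apply: (HM i); have := xac i; rewrite /= in_itv.
Qed.

(** Dominated convergence as the bumps steepen to the indicator of the box: they are at most 1 and
    vanish off the box, so [|h|] restricted to the box dominates. *)
Lemma integral_open_box0 h : h \in Lfun mu 2%:E ->
  (forall a c l, 0 < l ->
    (\int[mu]_x (h x * prod_fun (bump_box a c l) x)%:E = 0)%E) ->
  forall a c, (\int[mu]_(x in open_box a c) (h x)%:E = 0)%E.
Proof.
move=> h2 H a c.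
have mh := Lfun_measurable h2.
have mp l : 0 < l -> measurable_fun setT (prod_fun (bump_box a c l)).
  by move=> l0; apply: continuous_measurable_rV;
    apply: test_function_continuous; exact: bump_box_test.
have Ih := Lfun2_integrable_box a c h2.
pose F n x := (h x * prod_fun (bump_box a c n.+1%:R) x)%:E.
pose G x := (h x * \1_(open_box a c) x)%:E.
have mF n : measurable_fun setT (F n).
  by apply/measurable_EFinP; apply: measurable_funM => //; exact: mp.
have mG : measurable_fun setT G by exact: measurable_int Ih.
have FG : {ae mu, forall x, setT x -> F ^~ x @ \oo --> G x}.
  apply/nearW => x _; apply: cvg_EFin; first by near=> n.
  by apply: cvgM; [exact: cvg_cst|exact: cvg_bump_box].
have iG : mu.-integrable setT (abse \o G) by exact: integrable_abse.
have FleG : {ae mu, forall x n, setT x -> (`|F n x| <= (abse \o G) x)%E}.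
  apply/nearW => x n _; rewrite /= lee_fin !normrM ler_wpM2l//.
  have p0 : 0 <= prod_fun (bump_box a c n.+1%:R) x.
    by apply: prod_fun_ge0 => i t; exact: bump_ge0.
  rewrite indicE; have [xac|xac] := boolP (x \in open_box a c).
    by rewrite normr1 ger0_norm// prod_fun_le1// => i t;
      rewrite bump_ge0 bump_le1.
  rewrite (_ : prod_fun _ x = 0) ?normr0//.
  apply/eqP; apply: contraNT xac => px; rewrite inE => i.
  rewrite /= in_itv/=; apply: (@bump_supp _ _ _ n.+1%:R) => //.
  by apply: contra_neq px; rewrite /prod_fun (bigD1 i)//= /bump_box => ->;
    rewrite mul0r.
have [_ _ L] := dominated_convergence measurableT mF mG FG iG FleG.
rewrite integral_mkcond.
rewrite (_ : _ \_ _ = G); last first.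
  apply/funext => x; rewrite patchE /G indicE; case: ifPn => _;
    first by rewrite mulr1.
  by rewrite mulr0.
move: L; rewrite (_ : (fun n => _) = cst 0%E); last by apply/funext => n /=;
  rewrite H.
by move=> /(cvg_lim (@ereal_hausdorff R)) <-; rewrite lim_cst.
Unshelve. all: by end_near. Qed.

(** The positive and negative parts of [h] are densities of two measures that agree on open boxes,
    hence on all Borel sets; so the two parts coincide a.e. *)
Lemma fundamental_lemma h : h \in Lfun mu 2%:E ->
  (forall a c l, 0 < l ->
    (\int[mu]_x (h x * prod_fun (bump_box a c l) x)%:E = 0)%E) ->
  {ae mu, forall x, h x = 0}.
Proof.
move=> h2 H; have mh := Lfun_measurable h2.
(* A function in L^2 need not be integrable on the whole space, but it is on every box. *)
have ih a c : mu.-integrable (open_box a c) (EFin \o h).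
  have mac := measurable_open_box a c.
  have [_] := integrable_mkcond (mu := mu) (EFin \o h) mac; apply.
  rewrite (_ : _ \_ _ = (fun x => (h x * \1_(open_box a c) x)%:E));
    first exact: Lfun2_integrable_box.
  by apply/funext => x; rewrite patchE indicE; case: ifPn => _;
    rewrite ?mulr1 ?mulr0.
pose hp x := Num.max (h x) 0; pose hn x := Num.max (- h x) 0.
have hp0 x : 0 <= hp x by rewrite le_max lexx orbT.
have hn0 x : 0 <= hn x by rewrite le_max lexx orbT.
have hE x : h x = hp x - hn x by rewrite /hp /hn; have [?|?] := leP (h x) 0;
  have [?|?] := leP (- h x) 0; lra.
have mhp : measurable_fun setT hp by exact: measurable_maxr.
have mhn : measurable_fun setT hn.
  by apply: measurable_maxr => //; exact: measurableT_comp.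
have ihp a c : mu.-integrable (open_box a c) (EFin \o hp).
  apply: le_integrable (ih a c); first exact: measurable_open_box.
    by apply/measurable_EFinP; exact: measurable_funTS.
  move=> x _; rewrite /= lee_fin /hp; have [_|_] := leP (h x) 0;
    first by rewrite normr0.
  by [].
have ihn a c : mu.-integrable (open_box a c) (EFin \o hn).
  apply: le_integrable (ih a c); first exact: measurable_open_box.
    by apply/measurable_EFinP; exact: measurable_funTS.
  move=> x _; rewrite /= lee_fin /hn; have [_|_] := leP (- h x) 0;
    first by rewrite normr0.
  by rewrite normrN.
pose mp := density_measure mu mhp hp0; pose mn := density_measure mu mhn hn0.
have mpn (A : set Rd) : measurable A -> mp A = mn A.
  apply: (measure_unique open_boxes big_box).
  - exact: measurable_rV_open_boxes.
  - exact: open_boxes_setI.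
  - by move=> k; eexists; eexists.
  - exact: bigcup_big_box.
  - move=> _ [a [c ->]].
    have := integral_open_box0 h2 H a c.
    rewrite (eq_integral (fun x => (hp x)%:E - (hn x)%:E)%E); last first.
      by move=> x _; rewrite hE EFinB.
    rewrite (integralB (measurable_open_box a c) (ihp a c) (ihn a c)).
    have fp := integrable_fin_num (measurable_open_box a c) (ihp a c).
    have fn := integrable_fin_num (measurable_open_box a c) (ihn a c).
    rewrite /mp /mn !density_measureE /=.
    by move=> /eqP; rewrite sube_eq ?fin_num_adde_defl// add0e => /eqP.
  - move=> k; rewrite /mp density_measureE -ge0_fin_numE; last first.
      by apply: integral_ge0 => x _; rewrite lee_fin.
    exact: (integrable_fin_num (measurable_open_box _ _)
      (ihp (fun=> - k%:R) (fun=> k%:R))).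
(* Equal integrals give a.e. equality where the parts are integrable, so the argument runs on each
   [big_box k] and these exhaust the space. *)
have aek k : {ae mu, forall x, big_box k x -> h x = 0}.
  have := @integral_ae_eq _ Rd R mu _
    (measurable_open_box (fun=> - k%:R) (fun=> k%:R))
    (EFin \o hn) (EFin \o hp) (ihp _ _).
  have mhn' : measurable_fun (big_box k) (EFin \o hn).
    by apply/measurable_EFinP; exact: measurable_funTS.
  move=> /(_ mhn') H1; apply: filterS (H1 _) => [x /= E kx|A _ mA];
    last exact: mpn.
  by have [] := E kx; rewrite hE => ->; rewrite subrr.
apply: filterS (ae_foralln aek) => x Hx.
by have [k /(_ k (leqnn k)) Hk] := big_box_cover x; exact: Hx Hk.
Qed.
End fundamental_lemma.

(** * Weak derivatives *)

Section weak_partial_uniq.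
Context {R : realType} {d : nat}.
Notation Rd := 'rV[R]_d.
Notation mu := (lebesgue_rV R d).
Implicit Types (u v w g h : Rd -> R) (i j : 'I_d).

(** Both functions have the same integral against every product bump, and the fundamental lemma
    applies to [g - h]. *)
Lemma is_weak_partial_unique i u g h :
  g \in Lfun mu 2%:E -> h \in Lfun mu 2%:E ->
  is_weak_partial i u g -> is_weak_partial i u h ->
    {ae mu, forall x, g x = h x}.
Proof.
move=> g2 h2 ug uh.
have gh2 := Lfun2_lin 1 (-1) g2 h2.
have : {ae mu, forall x, 1 * g x + -1 * h x = 0}.
  apply: (fundamental_lemma gh2) => a c l l0.
  have tb := bump_box_test a c l0.
  have b2 := test_function_Lfun2 tb.
  rewrite integral_lin_mul// mul1e EFinN mulN1e.
  have /eqP := ug _ tb; rewrite (uh _ tb) eqe_opp => /eqP ->.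
  by rewrite subee//; exact/integrable_fin_num/Lfun2_mul_integrable.
by apply: filterS => x; rewrite mul1r mulN1r => /eqP; rewrite subr_eq0 => /eqP.
Qed.

(** [weak_partial] is a chosen representative, so it is linear only through a.e. uniqueness. *)
Lemma weak_partial_lin i a b u v : H1 u -> H1 v ->
  {ae mu, forall x, weak_partial i (fun y => a * u y + b * v y) x =
    a * weak_partial i u x + b * weak_partial i v x}.
Proof.
move=> Hu Hv.
have [gu ug] := weak_partialP i Hu; have [gv vg] := weak_partialP i Hv.
have [guv uvg] := weak_partialP i (H1_lin a b Hu Hv).
apply: (is_weak_partial_unique guv (Lfun2_lin a b gu gv) uvg).
by apply: is_weak_partial_lin => //; exact: H1_Lfun2.
Qed.

Definition shift_coord j (L : R) (a : 'I_d -> R) i :=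
  if i == j then a i + L else a i.

(* Testing against B(x_j) - B(x_j - L) times the other bumps, where B is the
   primitive of the j-th bump. *)
Lemma integral_bump_shift w j :
  w \in Lfun mu 2%:E ->
  (forall phi, test_function phi ->
    (\int[mu]_x (w x * partial j phi x)%:E = 0)%E) ->
  forall a c (l L : R), 0 < l -> 0 <= L ->
  (\int[mu]_x (w x * prod_fun (bump_box a c l) x)%:E =
   \int[mu]_x
     (w x * prod_fun (bump_box (shift_coord j L a) (shift_coord j L c) l)
       x)%:E)%E.
Proof.
move=> w2 H a c l L l0 L0.
have t1 := bump_box_test a c l0.
have t2 := bump_box_test (shift_coord j L a) (shift_coord j L c) l0.
have sb : smooth1 (bump_box a c l j).
  exact: smooth1_bump_box.
have [B [DB B0 B1]] :=
  compact_primitive (smooth1_continuous sb) (fun t => @bump_supp R _ _ _ t l0).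
have sB := smooth1_primitive DB sb.
pose f i := if i == j then (fun t => B t - B (t - L)) else bump_box a c l i.
have fj : smooth1 (fun t => B t - B (t - L)).
  exact: (smooth1B sB (@smooth1_shift R B L sB)).
have sf i : smooth1 (f i).
  by rewrite /f; case: ifP => _; [exact: fj|exact: smooth1_bump_box].
have [M HM] := open_box_cube a (fun i => c i + L).
have tf : test_function (prod_fun f).
  apply: (@test_function_prod R d f (M + (`|a j| + `|c j + L|)) sf) => i t.
  rewrite /f; have [ij|_] := eqVneq i j; last first.
    move=> /(bump_supp l0) /andP[at_ tc].
    have : `|t| <= M by apply: (HM i); rewrite at_/= (lt_le_trans tc)// lerDl.
    by have := normr_ge0 (a j); have := normr_ge0 (c j + L); lra.
  have M0 : a j < c j + L -> 0 <= M.
    move=> acL; apply: le_trans (normr_ge0 ((a j + (c j + L)) / 2)) _.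
    by apply: (HM j); lra.
  (* Left of [a j] both primitives vanish; right of [c j + L] both equal [B (c j)]. *)
  have [ta|at_] := leP t (a j); first by rewrite !B0 ?subrr ?eqxx//; lra.
  have [ct|tc] := leP (c j + L) t.
    by rewrite (B1 t) ?(B1 (t - L)) ?subrr ?eqxx//; lra.
  move=> _; have : `|t| <= M by apply: (HM j); rewrite at_ tc.
  by have := normr_ge0 (a j); have := normr_ge0 (c j + L); lra.
have DfE x : partial j (prod_fun f) x = 1 * prod_fun (bump_box a c l) x
    + -1 * prod_fun (bump_box (shift_coord j L a) (shift_coord j L c) l) x.
  rewrite (partial_prod_fun j sf) mul1r mulN1r /prod_fun !(bigD1 j erefl)/=.
  rewrite {1}/derive_at eqxx {1}/f eqxx.
  have -> : (fun t => B t - B (t - L))^`()%classic (x ord0 j) =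
      bump_box a c l j (x ord0 j) - bump_box (shift_coord j L a)
        (shift_coord j L c) l j (x ord0 j).
    rewrite derive1E.
    have D1 := DB (x ord0 j).
    have Ds : is_derive (x ord0 j) 1 (fun t => t - L) 1.
      by apply: is_derive_eq; rewrite subr0.
    have D2 :=
      @is_derive1_comp R B (fun t => t - L) (x ord0 j) _ _ (DB (x ord0 j - L))
        Ds.
    have [_ ->] := is_deriveB D1 D2.
    (* Evaluating a bump at [t - L] amounts to moving both its endpoints by [L]. *)
    rewrite mulr1 /bump_box /bump /shift_coord eqxx; congr (_ - _ * _).
      by congr (flat_exp _ (l * _)); lra.
    by congr (flat_exp _ (l * _)); lra.
  rewrite mulrBl; congr (_ * _ - _ * _).
    by apply: eq_bigr => i ij; rewrite /derive_at /f (negbTE ij).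
  by apply: eq_bigr => i ij;
    rewrite /derive_at /f /bump_box /shift_coord (negbTE ij).
have := H _ tf.
under eq_integral do rewrite DfE mulrC.
have p1 := test_function_Lfun2 t1; have p2 := test_function_Lfun2 t2.
rewrite (integral_lin_mul 1 (-1) p1 p2 w2) mul1e EFinN mulN1e.
under eq_integral do rewrite mulrC.
under [X in (_ - X)%E]eq_integral do rewrite mulrC.
have F2 := integrable_fin_num measurableT (Lfun2_mul_integrable w2 p2).
have F1 := integrable_fin_num measurableT (Lfun2_mul_integrable w2 p1).
move=> /eqP; rewrite (sube_eq F1 (fin_num_adde_defl _ F2)) add0e => /eqP.
exact.
Qed.

(** At a fixed [x] the [j]-th factor vanishes once [a j + n] exceeds the [j]-th coordinate of [x].
    Integrability of [w] on the whole space provides the domination. *)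
Lemma cvg_integral_bump_shift w j a c (l : R) : 0 < l ->
  mu.-integrable setT (EFin \o w) ->
  (\int[mu]_x
    (w x * prod_fun (bump_box (shift_coord j n%:R a) (shift_coord j n%:R c) l)
      x)%:E
    @[n --> \oo] --> 0)%E.
Proof.
move=> l0 iw.
have mw : measurable_fun setT w.
  by apply/measurable_EFinP; exact: measurable_int iw.
pose F n x :=
  (w x * prod_fun (bump_box (shift_coord j n%:R a) (shift_coord j n%:R c) l)
    x)%:E.
have mF n : measurable_fun setT (F n).
  apply/measurable_EFinP; apply: measurable_funM => //.
  by apply: continuous_measurable_rV; apply: test_function_continuous;
    exact: bump_box_test.
have mG : measurable_fun setT (cst 0%E : Rd -> \bar R) by [].
have FG : {ae mu, forall x, setT x -> F ^~ x @ \oo --> 0%E}.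
  apply/nearW => x _; apply: cvg_near_cst; near=> n.
  rewrite /F (_ : prod_fun _ x = 0) ?mulr0//.
  rewrite /prod_fun (bigD1 j)//= (_ : bump_box _ _ _ _ _ = 0) ?mul0r//.
  apply/eqP; apply: contraT => /(bump_supp l0);
    rewrite /shift_coord eqxx => /andP[+ _].
  have : x ord0 j - a j <= n%:R by near: n; exact: nbhs_infty_ger.
  by rewrite lerBlDl leNgt => /negP.
have iG : mu.-integrable setT (abse \o (EFin \o w)) by exact: integrable_abse.
have FleG :
  {ae mu, forall x n, setT x -> (`|F n x| <= (abse \o (EFin \o w)) x)%E}.
  apply/nearW => x n _; rewrite /= lee_fin normrM ler_piMr//.
  rewrite ger0_norm; first by apply: prod_fun_le1 => i t;
    rewrite bump_ge0 bump_le1.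
  by apply: prod_fun_ge0 => i t; exact: bump_ge0.
have [_ _] := dominated_convergence measurableT mF mG FG iG FleG.
by rewrite integral0.
Unshelve. all: by end_near.
Qed.

(** The integral against a bump does not change when the bump is shifted along direction [j], and it
    tends to 0 as the shift grows; hence it is 0. *)
Lemma weak_partial0 w j : w \in Lfun mu 2%:E ->
  mu.-integrable setT (EFin \o w) ->
  (forall phi, test_function phi ->
    (\int[mu]_x (w x * partial j phi x)%:E = 0)%E) ->
  {ae mu, forall x, w x = 0}.
Proof.
move=> w2 iw H; apply: fundamental_lemma => // a c l l0.
have := @cvg_integral_bump_shift w j a c l l0 iw.
rewrite (_ :
  (fun n => _) = cst (\int[mu]_x (w x * prod_fun (bump_box a c l) x)%:E)%E).
  by move=> /(cvg_lim (@ereal_hausdorff R)) <-; rewrite lim_cst.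
by apply/funext => n /=; rewrite -integral_bump_shift.
Qed.
End weak_partial_uniq.

(** * Convexity of the energy *)

Section pointwise.
Context {R : realType}.
Implicit Types (r : R -> R) (a s t g h : R).

(* If r decreased from s to t, concavity would make it negative far beyond t. *)
Lemma concave_pos_nondecreasing r : concave_nneg r ->
  (forall s, 0 <= s -> 0 < r s) ->
  forall s t, 0 <= s -> s <= t -> r s <= r t.
Proof.
move=> cr r0 s t s0; rewrite le_eqVlt => /predU1P[->//|st].
rewrite leNgt; apply/negP => rts.
have t0 : 0 <= t by rewrite (le_trans s0)// ltW.
have rt0 := r0 t t0.
(* Chosen so that [k (r s - r t)] exceeds [r t (t - s)] by 1. With [t = l s + (1 - l)(t + k)],
   concavity and positivity at [t + k] give the contrary inequality. *)
pose k := (r t * (t - s) + 1) / (r s - r t).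
have D0 : 0 < r s - r t by lra.
have ts0 : 0 < t - s by lra.
have k0 : 0 < k by rewrite divr_gt0// addr_gt0// mulr_gt0.
have ks0 : 0 < k + (t - s) by lra.
pose l := k / (k + (t - s)).
have l0 : 0 <= l by rewrite divr_ge0// ltW.
have l1 : l <= 1 by rewrite ler_pdivrMr// mul1r; lra.
have T0 : 0 <= t + k by lra.
have := cr s (t + k) l s0 T0; rewrite l0 l1 => /(_ isT).
have -> : l * s + (1 - l) * (t + k) = t by rewrite /l; field; lra.
have : 0 <= (1 - l) * r (t + k) by rewrite mulr_ge0 ?subr_ge0// ltW// r0.
move=> H1 H2; have : l * r s <= r t by lra.
rewrite /l mulrAC ler_pdivrMr//.
have : k * (r s - r t) = r t * (t - s) + 1 by rewrite /k mulfVK// gt_eqF.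
by rewrite mulrBr mulrDr [k * r t]mulrC; lra.
Qed.

(** The map [(g, p) |-> g^2 / p] is the perspective of the square. With [n = a p + (1 - a) q] in
    place of [m], the defect is [a (1 - a) (g q - h p)^2 / (p q n)]; passing to the larger [m]
    lowers the left side. *)
Lemma sqr_div_convex a g h p q m : 0 <= a <= 1 -> 0 < p -> 0 < q ->
  a * p + (1 - a) * q <= m ->
  (a * g + (1 - a) * h) ^+ 2 / m <= a * (g ^+ 2 / p) + (1 - a) * (h ^+ 2 / q).
Proof.
move=> /andP[a0 a1] p0 q0 pqm.
have b0 : 0 <= 1 - a by lra.
have n0 : 0 < a * p + (1 - a) * q.
  have [->|a'] := eqVneq a 0; first by rewrite mul0r add0r subr0 mul1r.
  by rewrite ltr_pwDl// ?mulr_gt0 ?mulr_ge0// ?lt_neqAle ?a0 1?eq_sym ?a'// ltW.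
set n := a * p + _ in n0 pqm *.
apply: (@le_trans _ _ ((a * g + (1 - a) * h) ^+ 2 / n)).
  by rewrite ler_wpM2l ?sqr_ge0// lef_pV2// posrE (lt_le_trans n0).
rewrite -subr_ge0.
have -> : a * (g ^+ 2 / p) + (1 - a) * (h ^+ 2 / q)
    - (a * g + (1 - a) * h) ^+ 2 / n =
    a * (1 - a) * (g * q - h * p) ^+ 2 / (p * q * n).
  by rewrite /n; field; rewrite !lt0r_neq0.
apply: divr_ge0; last by apply: ltW; rewrite !mulr_gt0.
by apply: mulr_ge0; [exact: mulr_ge0|exact: sqr_ge0].
Qed.

(** Up to a constant, [preg sigma s] is the Euclidean norm of the vector [(s, sigma)], so this is
    the triangle inequality in the plane. *)
Lemma preg_convex sigma a s t : 0 <= a <= 1 ->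
  preg sigma (a * s + (1 - a) * t) <= a * preg sigma s + (1 - a) * preg sigma t.
Proof.
move=> /andP[a0 a1]; rewrite /preg.
have b0 : 0 <= 1 - a by lra.
have -> : a * (Num.sqrt (s ^+ 2 + sigma ^+ 2) - sigma) +
    (1 - a) * (Num.sqrt (t ^+ 2 + sigma ^+ 2) - sigma) =
   a * Num.sqrt (s ^+ 2 + sigma ^+ 2) +
     (1 - a) * Num.sqrt (t ^+ 2 + sigma ^+ 2) - sigma.
  by ring.
rewrite lerD2r.
have pos x : 0 <= x ^+ 2 + sigma ^+ 2 by rewrite addr_ge0 ?sqr_ge0.
have S2 := sqr_sqrtr (pos s); have T2 := sqr_sqrtr (pos t).
have S0 := sqrtr_ge0 (s ^+ 2 + sigma ^+ 2);
  have T0 := sqrtr_ge0 (t ^+ 2 + sigma ^+ 2).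
move: S2 T2 S0 T0;
  move: (Num.sqrt (s ^+ 2 + _)) (Num.sqrt (t ^+ 2 + _)) => S T S2 T2 S0 T0.
(* Cauchy-Schwarz for [(s, sigma)] and [(t, sigma)]; the squares differ by [(sigma (s - t))^2]. *)
have ST : s * t + sigma ^+ 2 <= S * T.
  apply: (le_trans (ler_norm _)); rewrite -(ger0_norm (mulr_ge0 S0 T0)).
  rewrite -ler_sqr ?nnegrE// !real_normK ?num_real//.
  rewrite exprMn S2 T2 -subr_ge0.
  have -> :
    (s ^+ 2 + sigma ^+ 2) * (t ^+ 2 + sigma ^+ 2) - (s * t + sigma ^+ 2) ^+ 2
     = (sigma * (s - t)) ^+ 2 by ring.
  exact: sqr_ge0.
have H0 : 0 <= a * S + (1 - a) * T by rewrite addr_ge0 ?mulr_ge0.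
rewrite -[leRHS]ger0_norm// -sqrtr_sqr ler_wsqrtr// -subr_ge0.
have -> :
  (a * S + (1 - a) * T) ^+ 2 - ((a * s + (1 - a) * t) ^+ 2 + sigma ^+ 2) =
   a ^+ 2 * (S ^+ 2 - (s ^+ 2 + sigma ^+ 2))
   + (1 - a) ^+ 2 * (T ^+ 2 - (t ^+ 2 + sigma ^+ 2))
   + 2 * (a * (1 - a)) * (S * T - (s * t + sigma ^+ 2)) by ring.
by rewrite S2 T2 !subrr !mulr0 !add0r !mulr_ge0// subr_ge0.
Qed.

Lemma preg_ge0 sigma s : 0 <= preg sigma s.
Proof.
rewrite subr_ge0; apply: (le_trans (ler_norm _)).
by rewrite -sqrtr_sqr ler_wsqrtr// lerDr sqr_ge0.
Qed.

Lemma preg_le sigma s : 0 <= sigma -> 0 <= s -> preg sigma s <= s.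
Proof.
move=> sg0 s0.
rewrite lerBlDr -[leRHS]ger0_norm ?addr_ge0// -sqrtr_sqr ler_wsqrtr//.
by rewrite sqrrD lerD2r lerDl mulrn_wge0// mulr_ge0.
Qed.

(** The integrand as a function of numbers: [v] stands for the potential, [s] for the density and
    [q] for the squared norm of its gradient. *)
Definition edensity r (sigma beta delta v s q : R) : R :=
  q / (8 * r s) + v * preg sigma s + beta / 2 * s ^+ 2 + delta / 2 * q.

(** The first two terms are convex by [sqr_div_convex], applied to each component, and
    [preg_convex]; the quadratic terms contribute the gap exactly. *)
Lemma edensity_convex r sigma beta delta v d (gu gv : 'I_d -> R) s t a :
  concave_nneg r -> (forall s, 0 <= s -> 0 < r s) ->
  0 <= v -> 0 <= s -> 0 <= t -> 0 <= a <= 1 ->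
  edensity r sigma beta delta v (a * s + (1 - a) * t)
     (\sum_(i < d) (a * gu i + (1 - a) * gv i) ^+ 2)
   + a * (1 - a) *
     (beta / 2 * (s - t) ^+ 2 + delta / 2 * \sum_(i < d) (gu i - gv i) ^+ 2)
  <= a * edensity r sigma beta delta v s (\sum_(i < d) gu i ^+ 2)
   + (1 - a) * edensity r sigma beta delta v t (\sum_(i < d) gv i ^+ 2).
Proof.
move=> cr r0 v0 s0 t0 a01; have /andP[a0 a1] := a01.
have b0 : 0 <= 1 - a by lra.
have rs := r0 s s0; have rt := r0 t t0.
have st0 : 0 <= a * s + (1 - a) * t by rewrite addr_ge0// mulr_ge0.
have H1 :
  (\sum_(i < d) (a * gu i + (1 - a) * gv i) ^+ 2) /
    (8 * r (a * s + (1 - a) * t))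
   <= a * ((\sum_(i < d) gu i ^+ 2) / (8 * r s)) +
     (1 - a) * ((\sum_(i < d) gv i ^+ 2) / (8 * r t)).
  rewrite !mulr_suml !mulr_sumr -big_split/=; apply: ler_sum => i _.
  apply: sqr_div_convex => //; rewrite ?mulr_gt0//.
  have := cr s t a s0 t0 a01; lra.
have H2 : v * preg sigma (a * s + (1 - a) * t) <=
   a * (v * preg sigma s) + (1 - a) * (v * preg sigma t).
  rewrite [a * (v * _)]mulrCA [(1 - a) * (v * _)]mulrCA -mulrDr ler_wpM2l//.
  exact: preg_convex.
have H3 : \sum_(i < d) (a * gu i + (1 - a) * gv i) ^+ 2 +
    a * (1 - a) * \sum_(i < d) (gu i - gv i) ^+ 2 =
    a * (\sum_(i < d) gu i ^+ 2) + (1 - a) * (\sum_(i < d) gv i ^+ 2).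
  rewrite !mulr_sumr -!big_split/=; apply: eq_bigr => i _; ring.
rewrite /edensity.
move: (\sum_(i < d) (a * gu i + (1 - a) * gv i) ^+ 2)
  (\sum_(i < d) (gu i - gv i) ^+ 2)
  (\sum_(i < d) gu i ^+ 2) (\sum_(i < d) gv i ^+ 2) H1 H3 => qm qd qu qv H1 H3.
rewrite -subr_ge0 in H1; rewrite -subr_ge0 in H2; rewrite -subr_ge0.
set X := _ / (8 * r (a * s + _)) in H1 *.
set Y := _ / (8 * r s) in H1 *; set Z := _ / (8 * r t) in H1 *.
set P := v * preg _ (a * s + _) in H2 *.
set P1 := v * preg _ s in H2 *; set P2 := v * preg _ t in H2 *.
have -> : qm = a * qu + (1 - a) * qv - a * (1 - a) * qd by lra.
(* After elimination of [qm], the difference of the two sides is exactly the sum of the defects in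
   [H1] and [H2]. *)
apply: le_trans (addr_ge0 H1 H2) _; rewrite le_eqVlt; apply/orP; left;
  apply/eqP.
by field.
Qed.
End pointwise.

Lemma ge0_integral_lin dp (T : measurableType dp) (R : realType)
    (mu : {measure set T -> \bar R}) (f g : T -> R) (k l : R) :
  measurable_fun setT f -> measurable_fun setT g ->
  (forall x, 0 <= f x) -> (forall x, 0 <= g x) -> 0 <= k -> 0 <= l ->
  (k%:E * \int[mu]_x (f x)%:E + l%:E * \int[mu]_x (g x)%:E =
   \int[mu]_x (k * f x + l * g x)%:E)%E.
Proof.
move=> mf mg f0 g0 k0 l0.
have mf' : measurable_fun setT (EFin \o f) by exact/measurable_EFinP.
have mg' : measurable_fun setT (EFin \o g) by exact/measurable_EFinP.
rewrite -(ge0_integralZl_EFin _ measurableT _ mf' k0); last first.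
  by move=> x _; rewrite lee_fin.
rewrite -(ge0_integralZl_EFin _ measurableT _ mg' l0); last first.
  by move=> x _; rewrite lee_fin.
rewrite -ge0_integralD//.
- by move=> x _; rewrite lee_fin mulr_ge0.
- by apply: measurable_funeM.
- by move=> x _; rewrite lee_fin mulr_ge0.
- by apply: measurable_funeM.
Qed.

(** * Finiteness and convexity of the energy *)

Section energy.
Context {R : realType} {d : nat}.
Notation Rd := 'rV[R]_d.
Notation mu := (lebesgue_rV R d).
Variables (r : R -> R) (V V0 : Rd -> R) (beta delta sigma : R).
Hypotheses (cr : concave_nneg r) (r0 : forall s : R, 0 <= s -> 0 < r s).
Hypotheses (V_ge0 : forall x, 0 <= V x) (mV0 : measurable_fun setT V0).
Hypothesis VV0 : {ae mu, forall x, V x = V0 x}.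
Hypotheses (beta0 : 0 <= beta) (delta0 : 0 <= delta) (sigma0 : 0 <= sigma).
Implicit Types rho u v : Rd -> R.

(* V and rho are replaced by nonnegative Borel functions which agree with them
   a.e., so that this is a nonnegative Borel function everywhere. *)
Definition borel_density rho (x : Rd) : R :=
  edensity r sigma beta delta (Num.max (V0 x) 0) (Num.max (rho x) 0)
    (sqnorm_grad rho x).

Lemma sqnorm_grad_ge0 rho x : 0 <= sqnorm_grad rho x.
Proof. by apply: sumr_ge0 => i _; exact: sqr_ge0. Qed.

Lemma measurable_weak_partial rho i : H1 rho ->
  measurable_fun setT (weak_partial i rho).
Proof. by move=> /(weak_partialP i)[/Lfun_measurable]. Qed.

Lemma measurable_sqnorm_grad rho : H1 rho ->
  measurable_fun setT (sqnorm_grad rho).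
Proof.
move=> Hrho; apply: measurable_sum => i.
by apply: measurable_funX; exact: measurable_weak_partial.
Qed.

Lemma sqnorm_grad_integrable rho : H1 rho ->
  mu.-integrable setT (EFin \o sqnorm_grad rho).
Proof.
move=> Hrho.
rewrite (_ : EFin \o _ =
    (fun x => \sum_(i < d) (weak_partial i rho x ^+ 2)%:E)%E).
  apply: integrable_sum => // i _; apply: Lfun2_integrable_sqr.
  by have [] := weak_partialP i Hrho.
by apply/funext => x; rewrite /= /sqnorm_grad sumEFin.
Qed.

Lemma borel_density_ge0 rho x : 0 <= borel_density rho x.
Proof.
have m0 (y : R) : 0 <= Num.max y 0 by rewrite le_max lexx orbT.
rewrite /borel_density /edensity !addr_ge0//
  ?mulr_ge0 ?sqnorm_grad_ge0 ?preg_ge0 ?sqr_ge0 ?divr_ge0//.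
by rewrite invr_ge0 mulr_ge0// ltW// r0.
Qed.

Lemma measurable_borel_density rho : H1 rho ->
  measurable_fun setT (borel_density rho).
Proof.
move=> Hrho.
have mrho := Lfun_measurable (H1_Lfun2 Hrho).
have mrho0 : measurable_fun setT (fun x => Num.max (rho x) 0) by
  exact: measurable_maxr.
have m0 (y : R) : 0 <= Num.max y 0 by rewrite le_max lexx orbT.
have mQ := measurable_sqnorm_grad Hrho.
rewrite /borel_density /edensity.
apply: measurable_funD; last exact: measurable_funM.
apply: measurable_funD; last first.
  by apply: measurable_funM => //; exact: measurable_funX.
apply: measurable_funD.
  apply: measurable_funM => //.
  (* [r] is nondecreasing on [[0, +oo[]; truncation at 0 and the minus sign make this function
     nondecreasing on the whole line, hence Borel. *)
  have mr : measurable_fun setT (fun s : R => - (8 * r (Num.max s 0))^-1).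
    apply: nondecreasing_measurable => // s t st.
    rewrite lerN2 lef_pV2 ?posrE ?mulr_gt0 ?r0// ler_pM2l//.
    apply: concave_pos_nondecreasing => //.
    by have [?|?] := leP s 0; have [?|?] := leP t 0; lra.
  rewrite (_ :
    (fun x => _) = -%R \o ((fun s : R => - (8 * r (Num.max s 0))^-1) \o rho));
      last first.
    by apply/funext => x /=; rewrite opprK.
  by apply: measurableT_comp => //; exact: measurableT_comp mr mrho.
apply: measurable_funM; first exact: measurable_maxr.
rewrite /preg; apply: measurable_funB => //.
apply: (@measurableT_comp _ _ _ _ _ _ (@Num.sqrt R)).
  by apply: continuous_measurable_fun; exact: sqrt_continuous.
by apply: measurable_funD => //; exact: measurable_funX.
Qed.

Lemma ae_borel_density rho : {ae mu, forall x, 0 <= rho x} ->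
  {ae mu, forall x,
    edensity r sigma beta delta (V x) (rho x) (sqnorm_grad rho x) =
    borel_density rho x}.
Proof.
apply: filterS2 VV0 => x Vx rx; rewrite /borel_density -Vx.
by rewrite max_l ?V_ge0// max_l.
Qed.

Lemma energyE rho : {ae mu, forall x, 0 <= rho x} ->
  energy r V sigma beta delta rho = (\int[mu]_x (borel_density rho x)%:E)%E.
Proof.
move=> rho0; apply: eq_integral_ae.
by apply: filterS (ae_borel_density rho0) => x <-.
Qed.

(** Since [r 0 <= r s] and [preg sigma s <= s] for [s >= 0], the integrand is at most
    [K |grad rho|^2 + V rho + beta/2 rho^2] a.e., and each term is integrable. *)
Lemma energy_lty rho : admissible V rho ->
  (\int[mu]_x (borel_density rho x)%:E < +oo)%E.
Proof.
move=> [Hrho rho0 _ Vrho].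
have m0 (y : R) : 0 <= Num.max y 0 by rewrite le_max lexx orbT.
have mrho := Lfun_measurable (H1_Lfun2 Hrho).
have mrho0 : measurable_fun setT (fun x => Num.max (rho x) 0) by
  exact: measurable_maxr.
pose K : R := (8 * r 0)^-1 + delta / 2.
have K0 : 0 <= K.
  by rewrite addr_ge0 ?divr_ge0// invr_ge0 mulr_ge0// ltW// r0.
have iQ := sqnorm_grad_integrable Hrho.
have iV :
  mu.-integrable setT (fun x => (Num.max (V0 x) 0 * Num.max (rho x) 0)%:E).
  apply/integrableP; split.
    by apply/measurable_EFinP; apply: measurable_funM => //;
      exact: measurable_maxr.
  apply: le_lt_trans Vrho; rewrite le_eqVlt; apply/orP; left; apply/eqP.
  apply: eq_integral_ae; apply: filterS2 VV0 rho0 => x Vx rx.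
  by rewrite -Vx max_l// max_l// gee0_abs// lee_fin mulr_ge0.
have iR : mu.-integrable setT (fun x => (rho x ^+ 2)%:E).
  exact: Lfun2_integrable_sqr (H1_Lfun2 Hrho).
have iS := integrableD measurableT (integrableD measurableT
  (integrableZl measurableT K iQ) iV) (integrableZl measurableT (beta / 2) iR).
apply: le_lt_trans (integrable_lty measurableT iS).
apply: ge0_le_integral => //.
- by move=> x _; rewrite lee_fin borel_density_ge0.
- by apply/measurable_EFinP; exact: measurable_borel_density.
- exact: measurable_int iS.
move=> x _; rewrite /= -!EFinM -!EFinD lee_fin /borel_density /edensity.
have H1 : sqnorm_grad rho x / (8 * r (Num.max (rho x) 0)) <=
  (8 * r 0)^-1 * sqnorm_grad rho x.
  rewrite mulrC ler_wpM2r ?sqnorm_grad_ge0// lef_pV2 ?posrE ?mulr_gt0 ?r0//.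
  by rewrite ler_pM2l//; apply: concave_pos_nondecreasing.
have H2 : Num.max (V0 x) 0 * preg sigma (Num.max (rho x) 0) <=
  Num.max (V0 x) 0 * Num.max (rho x) 0.
  by rewrite ler_wpM2l// preg_le.
have H3 : beta / 2 * Num.max (rho x) 0 ^+ 2 <= beta / 2 * rho x ^+ 2.
  rewrite ler_wpM2l ?divr_ge0//; have [?|?] := leP (rho x) 0; last by [].
  by rewrite expr0n sqr_ge0.
by rewrite /K; lra.
Qed.

Lemma ae_ge0_mix a u v : 0 <= a <= 1 -> {ae mu, forall x, 0 <= u x} ->
  {ae mu, forall x, 0 <= v x} -> {ae mu, forall x, 0 <= mix a u v x}.
Proof.
move=> /andP[a0 a1]; apply: filterS2 => x ux vx.
by rewrite /mix addr_ge0 ?mulr_ge0 ?subr_ge0.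
Qed.

(** A lower bound for the pointwise convexity defect, with the factor [a (1 - a)] removed. *)
Definition gap u v (x : Rd) : R := beta / 2 * (u x - v x) ^+ 2 +
  delta / 2 * \sum_(i < d) (weak_partial i u x - weak_partial i v x) ^+ 2.

Lemma gap_ge0 u v x : 0 <= gap u v x.
Proof.
by rewrite addr_ge0// mulr_ge0 ?divr_ge0// ?sqr_ge0//; apply: sumr_ge0 => i _;
  rewrite sqr_ge0.
Qed.

Lemma measurable_gap u v : H1 u -> H1 v -> measurable_fun setT (gap u v).
Proof.
move=> Hu Hv.
have mu_ := Lfun_measurable (H1_Lfun2 Hu).
have mv_ := Lfun_measurable (H1_Lfun2 Hv).
apply: measurable_funD; apply: measurable_funM => //.
  by apply: measurable_funX; exact: measurable_funB.
apply: measurable_sum => i; apply: measurable_funX.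
by apply: measurable_funB; exact: measurable_weak_partial.
Qed.

(** Outside the union of finitely many null sets the chosen weak partials are linear and [u], [v]
    are nonnegative; there [edensity_convex] applies. *)
Lemma ae_density_convex a u v : admissible V u -> admissible V v ->
  0 <= a <= 1 ->
  {ae mu, forall x, borel_density (mix a u v) x + a * (1 - a) * gap u v x <=
     a * borel_density u x + (1 - a) * borel_density v x}.
Proof.
move=> [Hu u0 _ _] [Hv v0 _ _] a01.
have Hw : {ae mu, forall x, forall i : 'I_d, weak_partial i (mix a u v) x =
    a * weak_partial i u x + (1 - a) * weak_partial i v x}.
  apply: filter_forall => i; exact: weak_partial_lin.
apply: filterS3 Hw u0 v0 => x Hw ux vx.
have /andP[a0 a1] := a01.
have w0 : 0 <= a * u x + (1 - a) * v x by rewrite addr_ge0 ?mulr_ge0 ?subr_ge0.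
have m0 (y : R) : 0 <= Num.max y 0 by rewrite le_max lexx orbT.
rewrite /borel_density /mix !(max_l ux, max_l vx, max_l w0).
rewrite {1}/sqnorm_grad; under eq_bigr do rewrite Hw.
exact: edensity_convex.
Qed.

(** With the gap added on the left, all integrands are nonnegative, so integration is additive
    without any finiteness. *)
Lemma energy_convex a u v : admissible V u -> admissible V v -> 0 <= a <= 1 ->
  (energy r V sigma beta delta (mix a u v) +
    (a * (1 - a))%:E * \int[mu]_x (gap u v x)%:E <=
   a%:E * energy r V sigma beta delta u +
     (1 - a)%:E * energy r V sigma beta delta v)%E.
Proof.
move=> Au Av a01; have /andP[a0 a1] := a01.
have b0 : 0 <= 1 - a by rewrite subr_ge0.
have [Hu u0 _ _] := Au; have [Hv v0 _ _] := Av.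
have Hmix : H1 (mix a u v) by exact: H1_lin.
rewrite !energyE//; last exact: ae_ge0_mix.
have mbd := measurable_borel_density.
have mg := measurable_gap Hu Hv.
rewrite -[X in (X + _)%E]mul1e.
rewrite [leLHS](ge0_integral_lin mu (mbd _ Hmix) mg (borel_density_ge0 _)
  (gap_ge0 _ _) ler01 (mulr_ge0 a0 b0)).
rewrite [leRHS](ge0_integral_lin mu (mbd _ Hu) (mbd _ Hv) (borel_density_ge0 _)
  (borel_density_ge0 _) a0 b0).
apply: le_integral_ae.
- by move=> x;
  rewrite lee_fin mul1r addr_ge0 ?mulr_ge0 ?borel_density_ge0 ?gap_ge0.
- by move=> x; rewrite lee_fin addr_ge0 ?mulr_ge0 ?borel_density_ge0.
- apply: filterS (ae_density_convex Au Av a01) => x.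
  by rewrite lee_fin mul1r.
Qed.
End energy.

(** * Positivity of the integrated gap *)

Section gap_zero.
Context {R : realType} {d : nat}.
Notation Rd := 'rV[R]_d.
Notation mu := (lebesgue_rV R d).
Variables (V : Rd -> R).
Implicit Types u v : Rd -> R.

(** Unit mass and a.e. nonnegativity give integrability, which the translation argument needs. *)
Lemma admissible_integrable u : admissible V u ->
  mu.-integrable setT (EFin \o u).
Proof.
move=> [Hu u0 u1 _]; apply/integrableP; split.
  by apply/measurable_EFinP; exact: Lfun_measurable (H1_Lfun2 Hu).
apply: (@le_lt_trans _ _ 1%E); last by rewrite ltry.
rewrite -u1 le_eqVlt; apply/orP; left; apply/eqP; apply: eq_integral_ae.
by apply: filterS u0 => x ux; rewrite gee0_abs.
Qed.

(** If the integral were 0, the gap would vanish a.e.; as [delta > 0], so would the weak gradient of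
    [u - v], and [weak_partial0] would give [u = v] a.e. *)
Lemma gap_integral_gt0 beta delta u v : (1 <= d)%N -> 0 <= beta -> 0 < delta ->
  admissible V u -> admissible V v -> ~ {ae mu, forall x, u x = v x} ->
  (0 < \int[mu]_x (gap beta delta u v x)%:E)%E.
Proof.
move=> d1 beta0 delta0 Au Av uv.
have [Hu u0 _ _] := Au; have [Hv v0 _ _] := Av.
have u2 := H1_Lfun2 Hu; have v2 := H1_Lfun2 Hv.
have g0 x : 0 <= gap beta delta u v x by apply: gap_ge0 => //; exact: ltW.
rewrite lt_neqAle integral_ge0 ?andbT; last by move=> x _; rewrite lee_fin.
rewrite eq_sym; apply/eqP => gap0; apply: uv.
have mg : measurable_fun setT (EFin \o gap beta delta u v).
  by apply/measurable_EFinP; exact: measurable_gap.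
have [+ _] := ae_eq_integral_abs mu measurableT mg.
under eq_integral do rewrite /= ger0_norm//.
move=> /(_ gap0) gapae.
(* One direction is enough, and [1 <= d] supplies it. *)
pose j : 'I_d := Ordinal d1.
have [gu ug] := weak_partialP j Hu; have [gv vg] := weak_partialP j Hv.
have Guv : {ae mu, forall x, weak_partial j u x - weak_partial j v x = 0}.
  apply: filterS gapae => x /(_ I) [/eqP].
  rewrite /gap paddr_eq0; first last.
  - by rewrite mulr_ge0 ?divr_ge0 ?(ltW delta0)//; apply: sumr_ge0 => i _;
    exact: sqr_ge0.
  - by rewrite mulr_ge0 ?divr_ge0 ?sqr_ge0.
  move=> /andP[_]; rewrite mulf_eq0 gt_eqF ?divr_gt0//= psumr_eq0;
    last by move=> i _; exact: sqr_ge0.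
  by move=> /allP/(_ j (mem_index_enum _)); rewrite sqrf_eq0 => /eqP.
have w2 := Lfun2_lin 1 (-1) u2 v2.
have wG := is_weak_partial_lin 1 (-1) u2 v2 gu gv ug vg.
have iw : mu.-integrable setT (EFin \o (fun x => 1 * u x + -1 * v x)).
  have := integrableB measurableT (admissible_integrable Au)
    (admissible_integrable Av).
  by apply: eq_integrable => // x _ /=; rewrite mul1r mulN1r.
have w0 : {ae mu, forall x, 1 * u x + -1 * v x = 0}.
  apply: (weak_partial0 w2 iw (j := j)) => phi tphi; rewrite wG//.
  rewrite (@eq_integral_ae _ _ _ _ _ (cst 0%E)) ?integral0 ?oppe0//.
  by apply: filterS Guv => x; rewrite mul1r mulN1r => ->; rewrite mul0r.
by apply: filterS w0 => x /eqP; rewrite mul1r mulN1r subr_eq0 => /eqP.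
Qed.

Lemma L2norm_sqr u : (L2norm u ^+ 2 = \int[mu]_x (u x ^+ 2)%:E)%E.
Proof.
rewrite /L2norm unlock poweR12_sqrt; last first.
  by apply: integral_ge0 => x _; exact: poweR_ge0.
rewrite sqr_sqrte; last by apply: integral_ge0 => x _; exact: poweR_ge0.
by apply: eq_integral => x _; rewrite /= powR_mulrn// real_normK// num_real.
Qed.
End gap_zero.

(** * Strict and strong convexity *)

Theorem proposition2p4 (R : realType) (d : nat) (r : R -> R -> R) (eps : R)
    (V : 'rV[R]_d -> R) (beta delta sigma : R) :
  (1 <= d)%N -> 0 < eps ->
  admissible_denominators r ->
  lebesgue_measurable_fun V -> (forall x, 0 <= V x) ->
  0 <= beta -> 0 < delta -> 0 < sigma ->
  strictly_convex_on (admissible V) (energy (r eps) V sigma beta delta) /\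
  (0 < beta ->
   strongly_convex_on (admissible V) (energy (r eps) V sigma beta delta) L2norm).
Proof.
move=> d1 eps0 [/(_ _ eps0)[_ r0 cr] _ _] mV V0 beta0 delta0 sigma0.
(* [W] is a Borel function equal to [V] a.e. *)
have [W mW VW] := completed_measurable_fun_ae mV.
set E := energy (r eps) V sigma beta delta.
have convE := energy_convex sigma cr r0 V0 mW VW beta0 (ltW delta0).
have EE := energyE (r eps) beta delta sigma V0 VW.
have E_ge0 rho : {ae lebesgue_rV R d, forall x, 0 <= rho x} -> (0 <= E rho)%E.
  move=> rho0; rewrite /E EE//; apply: integral_ge0 => x _.
  by rewrite lee_fin borel_density_ge0// ltW.
have Efin rho : admissible V rho -> E rho \is a fin_num.
  move=> Ar; have [_ rho0 _ _] := Ar.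
  rewrite ge0_fin_numE ?E_ge0// /E EE//.
  exact: (energy_lty cr r0 V0 mW VW beta0 (ltW delta0) (ltW sigma0)).
split.
- move=> u v a Au Av uv /andP[a0 a1].
  have a01 : 0 <= a <= 1 by rewrite !ltW.
  have ab0 : 0 < a * (1 - a) by rewrite mulr_gt0// subr_gt0.
  have I0 := gap_integral_gt0 d1 beta0 delta0 Au Av uv.
  have le := convE a u v Au Av a01; apply: lt_le_trans (le).
  have [_ u0 _ _] := Au; have [_ v0 _ _] := Av.
  have mix0 := E_ge0 _ (ae_ge0_mix a01 u0 v0).
  (* Adding a positive amount is strict only on a finite value; the energy of the mixture is finite
     because the convexity inequality bounds it by finite energies. *)
  rewrite lteDl ?mule_gt0 ?lte_fin// ge0_fin_numE//.
  apply: (@le_lt_trans _ _ (a%:E * E u + (1 - a)%:E * E v)%E).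
    by apply: le_trans le; rewrite leeDl// mule_ge0 ?lee_fin ?ltW.
  have : (a%:E * E u + (1 - a)%:E * E v)%E \is a fin_num.
    by rewrite fin_numD; apply/andP; split; apply: fin_numM;
      [exact: isT|exact: Efin|exact: isT|exact: Efin].
  by rewrite fin_numElt => /andP[].
(* The constant is [beta]: the gradient part of the gap is dropped and [beta/2 (u - v)^2] is
   kept. *)
- move=> beta_gt0; exists beta => // u v a Au Av a01.
  have /andP[a0 a1] := a01.
  have ab0 : 0 <= a * (1 - a) by rewrite mulr_ge0// subr_ge0.
  have [Hu _ _ _] := Au; have [Hv _ _ _] := Av.
  have iw : (lebesgue_rV R d).-integrable setT (fun x => ((u x - v x) ^+ 2)%:E).
    apply: eq_integrable
      (Lfun2_integrable_sqr (Lfun2_lin 1 (-1) (H1_Lfun2 Hu) (H1_Lfun2 Hv))) =>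
        //.
    by move=> x _ /=; rewrite mul1r mulN1r.
  have Nfin := integrable_fin_num measurableT iw.
  (* The L^2 norm of [u - v] is finite, so the subtracted term can move to the other side. *)
  rewrite L2norm_sqr leeBrDr ?fin_numM//.
  apply: le_trans (convE a u v Au Av a01); rewrite leeD2l//.
  have -> : beta / 2 * a * (1 - a) = a * (1 - a) * (beta / 2) by ring.
  rewrite EFinM -muleA.
  rewrite lee_wpmul2l//.
  rewrite -(integralZl measurableT iw); apply: ge0_le_integral => //.
  + by move=> x _; rewrite lee_fin mulr_ge0 ?divr_ge0// sqr_ge0.
  + exact: measurable_int (integrableZl measurableT (beta / 2) iw).
  + by apply/measurable_EFinP; exact: measurable_gap.
  + move=> x _; rewrite lee_fin lerDl mulr_ge0 ?divr_ge0 ?(ltW delta0)//.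
    by apply: sumr_ge0 => i _; exact: sqr_ge0.
Qed.
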